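(* Let $(R,\mathfrak m)$ be a Cohen-Macaulay local ring of dimension $d$ with infinite residue field, and let $I$ be an $\mathfrak m$-primary ideal of $R$ containing a parameter ideal $Q=(x_1,\ldots,x_d)$ as a reduction. Then every Ulrich $R$-module with respect to $I$ has minimal multiplicity with respect to $I$.
   Context: All rings are commutative and Noetherian with 1. A finitely generated $R$-module $M$ is maximal Cohen-Macaulay if $\mathrm{depth}_R M=\dim R$ (the zero module, of depth $+\infty$, is not). A parameter ideal is an ideal generated by a system of parameters. That $Q\subset I$ is a reduction of $I$ means $QI^r=I^{r+1}$ for some $r\ge 0$. A finitely generated $R$-module $M$ is Ulrich with respect to $I$ if $M$ is maximal Cohen-Macaulay, $IM=QM$, and $M/IM$ is a free $R/I$-module. A Cohen-Macaulay $R$-module $M$ of dimension $t$ has minimal multiplicity with respect to $I$ if $\mathrm e^0_I(M)=(1-t)\,\ell_R(M/IM)+\ell_R(IM/I^2M)$, where $\mathrm e^0_I(M)$ is the multiplicity of $M$ with respect to $I$ and $\ell_R$ denotes length. *)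

(* Defs.v *)
From HB Require Import structures.
From mathcomp Require Import all_boot all_order all_algebra.
From mathcomp Require Import boolp classical_sets functions cardinality.

Set Implicit Arguments.
Unset Strict Implicit.
Unset Printing Implicit Defensive.

Import Order.TTheory GRing.Theory Num.Theory.
Local Open Scope classical_set_scope.
Local Open Scope ring_scope.

(* Ideals and submodules are Prop-valued sets.  [GRing.submod_closed] is the
   library's "submodule"; [idealr_closed] is the library's "proper ideal". *)

Definition submodule (R : comNzRingType) (M : lmodType R) (N : set M) : Prop :=
  GRing.submod_closed (mem N).

Definition ideal (R : comNzRingType) (J : set R) : Prop :=
  submodule (J : set R^o).

Definition is_proper_ideal (R : comNzRingType) (J : set R) : Prop :=
  idealr_closed (mem J).

Definition prime_ideal (R : comNzRingType) (P : set R) : Prop :=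
  is_proper_ideal P /\ prime_idealr_closed (mem P).

Definition maximal_ideal (R : comNzRingType) (m : set R) : Prop :=
  is_proper_ideal m /\ forall J : set R, is_proper_ideal J -> m `<=` J -> J = m.

Definition submod_gen (R : comNzRingType) (M : lmodType R) (A : set M) :
  set M := smallest (@submodule R M) A.

Definition ideal_gen (R : comNzRingType) (A : set R) : set R :=
  smallest (@ideal R) A.

(* The submodule J N of M; for M = R^o it is the product of two ideals. *)
Definition smul (R : comNzRingType) (M : lmodType R) (J : set R) (N : set M) :
  set M := submod_gen [set a *: u | a in J & u in N].

Definition ideal_mul (R : comNzRingType) (J K : set R) : set R :=
  smul J (K : set R^o).

Definition ideal_exp (R : comNzRingType) (J : set R) (n : nat) : set R :=
  iter n (ideal_mul J) setT.

Definition radical (R : comNzRingType) (J : set R) : set R :=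
  [set a | exists n : nat, J (a ^+ n)].

Definition noetherian (R : comNzRingType) : Prop :=
  forall J : set R, ideal J -> exists s : seq R, J = ideal_gen [set` s].

Definition finitely_generated (R : comNzRingType) (M : lmodType R) : Prop :=
  exists s : seq M, submod_gen [set` s] = setT.

Definition local_ring (R : comNzRingType) (m : set R) : Prop :=
  maximal_ideal m /\ forall n : set R, maximal_ideal n -> n = m.

(* The residue field is the set of cosets a + m. *)
Definition infinite_residue_field (R : comNzRingType) (m : set R) : Prop :=
  infinite_set (range (fun a : R => [set a + b | b in m])).

Definition primary_to (R : comNzRingType) (m J : set R) : Prop :=
  [/\ is_proper_ideal J,
      forall a b : R, J (a * b) -> J a \/ radical J b &
      radical J = m].

(* n is the supremum of the lengths k of the strict chains
   C 0 < C 1 < ... < C k of members of F. *)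
Definition chain_in (T : Type) (F : set (set T)) (k : nat) (C : nat -> set T) :
  Prop :=
  (forall i : nat, (i <= k)%N -> F (C i)) /\
  (forall i : nat, (i < k)%N -> C i `<` C i.+1).

Definition sup_chain_length (T : Type) (F : set (set T)) (n : nat) : Prop :=
  (exists C : nat -> set T, chain_in F n C) /\
  (forall (k : nat) (C : nat -> set T), chain_in F k C -> (k <= n)%N).

(* The quotient N / L has finite length n: submodules of N / L are the
   submodules between L and N. *)
Definition quot_length (R : comNzRingType) (M : lmodType R) (N L : set M)
  (n : nat) : Prop :=
  sup_chain_length [set K : set M | [/\ submodule K, L `<=` K & K `<=` N]] n.

Definition ring_dim (R : comNzRingType) (n : nat) : Prop :=
  sup_chain_length (@prime_ideal R) n.

Definition annihilator (R : comNzRingType) (M : lmodType R) : set R :=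
  [set a | forall u : M, a *: u = 0].

(* dim M = dim R / Ann M. *)
Definition module_dim (R : comNzRingType) (M : lmodType R) (n : nat) : Prop :=
  sup_chain_length
    [set P : set R | prime_ideal P /\ annihilator M `<=` P] n.

Definition regular_seq (R : comNzRingType) (M : lmodType R) (s : seq R) :
  Prop :=
  (forall i : nat, (i < size s)%N -> forall u : M,
     smul (ideal_gen [set` take i s]) setT (s`_i *: u) ->
     smul (ideal_gen [set` take i s]) setT u) /\
  smul (ideal_gen [set` s]) setT <> [set: M].

(* Depth over the local ring with maximal ideal m: the supremum of the lengths
   of M-regular sequences in m.  On the zero module not even the empty sequence
   is regular, so the zero module has no finite depth. *)
Definition depth (R : comNzRingType) (m : set R) (M : lmodType R) (n : nat) :
  Prop :=
  (exists s : seq R,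
     [/\ size s = n, [set` s] `<=` m & regular_seq M s]) /\
  (forall s : seq R, [set` s] `<=` m -> regular_seq M s -> (size s <= n)%N).

Definition cohen_macaulay_ring (R : comNzRingType) (m : set R) (d : nat) :
  Prop :=
  ring_dim R d /\ depth m R^o d.

Definition cohen_macaulay_module (R : comNzRingType) (m : set R)
  (M : lmodType R) (t : nat) : Prop :=
  [/\ finitely_generated M, module_dim M t & depth m M t].

Definition maximal_cohen_macaulay (R : comNzRingType) (m : set R)
  (M : lmodType R) : Prop :=
  finitely_generated M /\ exists2 d : nat, ring_dim R d & depth m M d.

Definition system_of_parameters (R : comNzRingType) (m : set R) (d : nat)
  (x : d.-tuple R) : Prop :=
  ring_dim R d /\ primary_to m (ideal_gen [set` x]).

Definition reduction (R : comNzRingType) (Q J : set R) : Prop :=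
  Q `<=` J /\
  exists r : nat, ideal_mul Q (ideal_exp J r) = ideal_exp J r.+1.

(* The classes of e_0, ..., e_(n-1) form a basis of M / JM over R / J. *)
Definition quot_free (R : comNzRingType) (J : set R) (M : lmodType R) : Prop :=
  exists (n : nat) (e : 'I_n -> M),
    (forall u : M, exists c : 'I_n -> R,
       smul J setT (u - \sum_(i < n) c i *: e i)) /\
    (forall c : 'I_n -> R,
       smul J setT (\sum_(i < n) c i *: e i) -> forall i : 'I_n, J (c i)).

(* Q is the fixed parameter ideal that is a reduction of J. *)
Definition ulrich (R : comNzRingType) (m J Q : set R) (M : lmodType R) :
  Prop :=
  [/\ maximal_cohen_macaulay m M,
      smul J [set: M] = smul Q setT &
      quot_free J M].

(* P(n) is the length of M / J^(n+1) M for all large n. *)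
Definition hilbert_samuel_poly (R : comNzRingType) (J : set R)
  (M : lmodType R) (P : {poly rat}) : Prop :=
  exists n0 : nat, forall n : nat, (n0 <= n)%N ->
    exists2 l : nat,
      quot_length [set: M] (smul (ideal_exp J n.+1) setT) l &
      P.[n%:R] = l%:R.

(* The Hilbert-Samuel polynomial has degree t = dim M and leading coefficient
   e / t!. *)
Definition multiplicity (R : comNzRingType) (J : set R) (M : lmodType R)
  (e : int) : Prop :=
  exists (t : nat) (P : {poly rat}),
    [/\ module_dim M t, hilbert_samuel_poly J M P, size P = t.+1 &
        e%:~R = (t`!)%:R * lead_coef P].

Definition minimal_multiplicity (R : comNzRingType) (m J : set R)
  (M : lmodType R) : Prop :=
  exists t l0 l1 : nat,
    [/\ cohen_macaulay_module m M t,
        quot_length [set: M] (smul J setT) l0,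
        quot_length (smul J [set: M]) (smul (ideal_exp J 2) setT) l1 &
        multiplicity J M ((1 - t%:Z) * l0%:Z + l1%:Z)].

(* Main.v *)
Require Import Defs.
From mathcomp Require Import all_boot all_order all_algebra.
From mathcomp Require Import boolp classical_sets functions cardinality.
From mathcomp Require Import ring zify.

(** Since [I M = Q M], all powers satisfy [I^n M = Q^n M].  A maximal
    Cohen-Macaulay module has an M-regular sequence of length d in the maximal
    ideal; as its members are nilpotent modulo Q, the Koszul complex of
    (x_1, ..., x_d) on M is acyclic in degree 1, and by Nakayama's lemma
    x_1, ..., x_d is M-regular.  Hence [Q^n M / Q^(n+1) M] is a direct sum of
    copies of [M / Q M], so [M / I^(n+1) M] has length
    [binomial (n + d) d * l] with l the length of [M / I M].  The multiplicity
    is therefore l, while [I M / I^2 M] has length d l, and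
    (1 - d) l + d l = l. *)

Set Implicit Arguments.
Unset Strict Implicit.
Unset Printing Implicit Defensive.

Import Order.TTheory GRing.Theory Num.Theory.
Local Open Scope classical_set_scope.
Local Open Scope ring_scope.

(** * Submodules *)

(** The regular sequence [s] provided by depth has no a priori relation to (x_1, ..., x_d); the
    Koszul complex of the x_i links the two. A power of each member of [s] lies in Q, and Q kills
    the homology up to homotopy. A member of [s] also acts injectively on H_i once H_(i+1) vanishes
    modulo it. Vanishing thus descends one degree per member, from the trivial range above degree d,
    and d members reach exactly degree 1.

    Depth d serves a second time: the multiplicity is normalised by dim M, and the same sequence
    builds a chain of primes of length d above Ann M.

    Quotient modules are never formed. M/N is treated as congruence modulo N inside M, and the
    length of N/L is read from the submodules between L and N, so that isomorphism theorems become
    order isomorphisms. *)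

Section Submodule.
Variables (R : comNzRingType) (M : lmodType R).
Implicit Types (N K L U V : set M) (J : set R) (u v : M) (a b : R) (s : seq M).

Lemma submoduleP N :
  submodule N <-> N 0 /\ forall a u v, N u -> N v -> N (a *: u + v).
Proof.
split=> -[N0 Nl]; split.
- exact: set_mem N0.
- by move=> a u v /mem_set Nu /mem_set Nv; apply: set_mem; apply: Nl.
- exact: mem_set.
- by move=> a u v /set_mem Nu /set_mem Nv; apply: mem_set; apply: Nl.
Qed.

Lemma subm0 N : submodule N -> N 0.
Proof. by case/submoduleP. Qed.

Lemma submD N u v : submodule N -> N u -> N v -> N (u + v).
Proof. by case/submoduleP=> _ Nl Nu Nv; rewrite -[u]scale1r; apply: Nl. Qed.

Lemma submZ N a u : submodule N -> N u -> N (a *: u).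
Proof.
by move=> /submoduleP[N0 Nl] Nu; rewrite -[_ *: _]addr0; apply: Nl.
Qed.

Lemma submN N u : submodule N -> N u -> N (- u).
Proof. by move=> Ns Nu; rewrite -scaleN1r; apply: submZ. Qed.

Lemma submB N u v : submodule N -> N u -> N v -> N (u - v).
Proof. by move=> Ns Nu Nv; apply: submD => //; apply: submN. Qed.

Lemma submBl N u v : submodule N -> N (u - v) -> N u -> N v.
Proof.
by move=> Ns Nuv Nu; have := submB Ns Nu Nuv; rewrite opprB addrC subrK.
Qed.

Lemma submoduleT : submodule [set: M].
Proof. exact/submoduleP. Qed.

Lemma submodule0 : submodule [set (0 : M)].
Proof.
by apply/submoduleP; split=> // a u v /= -> ->; rewrite scaler0 addr0.
Qed.

Lemma submoduleI N K : submodule N -> submodule K -> submodule (N `&` K).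
Proof.
move=> Ns Ks; apply/submoduleP; split; first by split; apply: subm0.
by move=> a u v [Nu Ku] [Nv Kv]; split; apply: submD => //; apply: submZ.
Qed.

Lemma submodule_scale_preim a N : submodule N -> submodule [set u | N (a *: u)].
Proof.
move=> Ns; apply/submoduleP; split; first by rewrite /= scaler0; apply: subm0.
move=> c u v /= Nu Nv; rewrite scalerDr scalerA mulrC -scalerA.
by apply: submD => //; apply: submZ.
Qed.

Definition addm N K : set M := [set u + v | u in N & v in K].
Definition scalem a N : set M := [set a *: u | u in N].

Lemma addmP N K u : addm N K u <-> exists v w, [/\ N v, K w & u = v + w].
Proof.
split; first by case=> v Nv [w Kw <-]; exists v, w.
by case=> v [w [Nv Kw ->]]; exists v => //; exists w.
Qed.

Lemma submodule_addm N K : submodule N -> submodule K -> submodule (addm N K).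
Proof.
move=> Ns Ks; apply/submoduleP; split.
  by apply/addmP; exists 0, 0; split; rewrite ?addr0 //; apply: subm0.
move=> a _ _ [u Nu [u' Ku' <-]] [v Nv [v' Kv' <-]].
apply/addmP; exists (a *: u + v), (a *: u' + v'); split.
- by apply: submD => //; apply: submZ.
- by apply: submD => //; apply: submZ.
- by rewrite scalerDr addrACA.
Qed.

Lemma submodule_scalem a N : submodule N -> submodule (scalem a N).
Proof.
move=> Ns; apply/submoduleP; split.
  by exists 0; rewrite ?scaler0 //; apply: subm0.
move=> b _ _ [u Nu <-] [v Nv <-]; exists (b *: u + v).
  by apply: submD => //; apply: submZ.
by rewrite scalerDr !scalerA mulrC.
Qed.

Lemma sub_addml N K : submodule K -> N `<=` addm N K.
Proof.
by move=> Ks u Nu; apply/addmP; exists u, 0; rewrite addr0; split=> //;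
  apply: subm0.
Qed.

Lemma sub_addmr N K : submodule N -> K `<=` addm N K.
Proof.
by move=> Ns u Ku; apply/addmP; exists 0, u; rewrite add0r; split=> //;
  apply: subm0.
Qed.

Lemma addm_sub N K L : submodule L -> N `<=` L -> K `<=` L -> addm N K `<=` L.
Proof.
by move=> Ls NL KL _ [u Nu [v Kv <-]]; apply: submD; [| apply: NL | apply: KL].
Qed.

Lemma addmS N N' K K' : N `<=` N' -> K `<=` K' -> addm N K `<=` addm N' K'.
Proof.
move=> NN' KK' _ [u Nu [v Kv <-]]; exists u; first exact: NN'.
by exists v; first exact: KK'.
Qed.

Lemma scalem_sub a N : submodule N -> scalem a N `<=` N.
Proof. by move=> Ns _ [u Nu <-]; apply: submZ. Qed.

Lemma scalemS a N K : N `<=` K -> scalem a N `<=` scalem a K.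
Proof. by move=> NK _ [u /NK Ku <-]; exists u. Qed.

Lemma submodule_gen (A : set M) : submodule (submod_gen A).
Proof.
apply/submoduleP; split; first by move=> N [Ns _]; apply: subm0.
move=> a u v Au Av N NA; have [Ns _] := NA.
by apply: submD => //; [apply: submZ => //; exact: (Au N NA) | exact: (Av N NA)].
Qed.

Lemma sub_submod_gen (A : set M) : A `<=` submod_gen A.
Proof. exact: sub_gen_smallest. Qed.

Lemma submod_gen_sub (A N : set M) : submodule N -> A `<=` N -> submod_gen A `<=` N.
Proof. exact: smallest_sub. Qed.

Lemma submod_genS (A B : set M) : A `<=` B -> submod_gen A `<=` submod_gen B.
Proof.
move=> AB; apply: submod_gen_sub; first exact: submodule_gen.
by move=> u /AB; apply: sub_submod_gen.
Qed.

Lemma submod_gen_nil u : submod_gen [set` [::]] u -> u = 0.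
Proof. exact: (submod_gen_sub submodule0). Qed.

Lemma submod_gen_cons e s u : submod_gen [set` e :: s] u <->
  exists c t, submod_gen [set` s] t /\ u = c *: e + t.
Proof.
have Gs := submodule_gen [set` s]; split; last first.
  case=> c [t [st ->]]; have Ges := submodule_gen [set` e :: s].
  apply: (submD Ges); last first.
    by move: t st; apply: submod_genS => v /= sv; rewrite inE sv orbT.
  by apply: (submZ _ Ges); apply: sub_submod_gen; rewrite /= mem_head.
pose W : set M := [set u | exists c t, submod_gen [set` s] t /\ u = c *: e + t].
apply: (@submod_gen_sub _ W).
  apply/submoduleP; split.
    by exists 0, 0; rewrite scale0r addr0; split=> //; apply: subm0.
  move=> a _ _ [c [t [st ->]]] [c' [t' [st' ->]]].
  exists (a * c + c'), (a *: t + t'); split.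
    by apply: (submD Gs) => //; apply: (submZ _ Gs).
  by rewrite scalerDr scalerDl scalerA addrACA.
move=> v /=; rewrite inE => /orP[/eqP ->|sv].
  by exists 1, 0; rewrite scale1r addr0; split=> //; apply: subm0.
by exists 0, v; rewrite scale0r add0r; split=> //; apply: sub_submod_gen.
Qed.

Lemma submodule_smul J N : submodule (smul J N).
Proof. exact: submodule_gen. Qed.

Lemma smulM J N a u : J a -> N u -> smul J N (a *: u).
Proof. by move=> Ja Nu; apply: sub_submod_gen; exists a => //; exists u. Qed.

Lemma smul_sub J N K : submodule K ->
  (forall a u, J a -> N u -> K (a *: u)) -> smul J N `<=` K.
Proof.
by move=> Ks JNK; apply: submod_gen_sub => // _ [a Ja [u Nu <-]]; apply: JNK.
Qed.

Lemma smulS J J' N N' : J `<=` J' -> N `<=` N' -> smul J N `<=` smul J' N'.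
Proof.
move=> JJ NN; apply: smul_sub; first exact: submodule_smul.
by move=> a u Ja Nu; apply: smulM; [apply: JJ | apply: NN].
Qed.

Lemma smul_subr J N : submodule N -> smul J N `<=` N.
Proof. by move=> Ns; apply: smul_sub => // a u _; apply: submZ. Qed.

(* [transporter N] is the annihilator of the quotient M / N. *)
Definition transporter N : set R := [set a | forall u, N (a *: u)].

End Submodule.

Lemma ideal_transporter (R : comNzRingType) (M : lmodType R) (N : set M) :
  submodule N -> ideal (transporter N).
Proof.
move=> Ns; apply/submoduleP; split=> [u|a b c Nb Nc u].
  by rewrite scale0r; apply: subm0.
rewrite scalerDl -[X in X + _]scalerA.
by apply: submD => //; apply: submZ.
Qed.

Lemma ideal_preim (R : comNzRingType) (M : lmodType R) (N : set M) (u : M) :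
  submodule N -> ideal [set a : R | N (a *: u)].
Proof.
move=> Ns; apply/submoduleP; split=> [|a b c /= Nb Nc].
  by rewrite /= scale0r; apply: subm0.
rewrite scalerDl -[X in X + _]scalerA.
by apply: submD => //; apply: submZ.
Qed.

Lemma smul_gen_sub (R : comNzRingType) (M : lmodType R) (A : set R)
  (N K : set M) : submodule K -> (forall a u, A a -> N u -> K (a *: u)) ->
  smul (ideal_gen A) N `<=` K.
Proof.
move=> Ks AN; apply: smul_sub => // a u Aa Nu; move: a Aa.
apply: (submod_gen_sub (M := R^o) (N := [set a : R | K (a *: u)])).
  exact: ideal_preim.
by move=> a Aa; apply: AN.
Qed.

(** * Local rings *)

Section Local.
Variables (R : comNzRingType).
Implicit Types (J P : set R) (a b : R).

Lemma proper_idealP J : is_proper_ideal J <-> ideal J /\ ~ J 1.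
Proof.
split.
  case=> J0 J1 Jl; split; last by move/mem_set; apply/negP.
  by apply/(@submoduleP R R^o); split=> [|a u v /mem_set Ju /mem_set Jv];
    apply: set_mem => //; apply: Jl.
case=> /(@submoduleP R R^o)[J0 Jl] J1; split; first exact: mem_set.
  by apply/negP=> /set_mem.
by move=> a u v /set_mem Ju /set_mem Jv; apply: mem_set; apply: Jl.
Qed.

Lemma prime_idealP P : prime_ideal P <->
  [/\ ideal P, ~ P 1 & forall a b, P (a * b) -> P a \/ P b].
Proof.
split.
  case=> /proper_idealP[Pi P1] PM; split=> // a b /mem_set/PM/orP[]/set_mem;
    by [left | right].
case=> Pi P1 PM; split; first exact/proper_idealP.
by move=> a b /set_mem/PM[]/mem_set ->; rewrite ?orbT.
Qed.

Lemma maximal_avoiding J (S : set R) : ideal J -> (forall a, J a -> ~ S a) ->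
  exists P, [/\ ideal P, J `<=` P, (forall a, P a -> ~ S a) &
    forall P', ideal P' -> P `<=` P' -> (forall a, P' a -> ~ S a) -> P' `<=` P].
Proof.
move=> Ji JS.
pose good P := [/\ ideal P, J `<=` P & forall a, P a -> ~ S a].
have [F FP Ftot|A [PA Amax]] := @Zorn_bigcup R [set P | P = set0 \/ good P].
  have [[X0 FX0 gX0]|noX] := pselect (exists2 X, F X & good X); last first.
    left; apply/seteqP; split=> // a [X FX Xa]; case: (FP X FX) => [X0|gX].
      by rewrite -X0.
    by case: noX; exists X.
  right; split.
  - apply/(@submoduleP R R^o); split.
      by exists X0 => //; case: gX0 => /(@subm0 R R^o).
    move=> a u v [X FX Xu] [Y FY Yv].
    have Fi Z : F Z -> Z !=set0 -> ideal Z.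
      by move=> /FP [->|[]//] [z].
    have [XY|YX] := Ftot _ _ FX FY.
      exists Y => //.
      have Yi : ideal Y by apply: Fi => //; exists v.
      apply: (submD (M := R^o)) => //; apply: (submZ (M := R^o)) => //.
      exact: XY.
    exists X => //.
    have Xi : ideal X by apply: Fi => //; exists u.
    apply: (submD (M := R^o)) => //; first exact: (submZ (M := R^o)).
    exact: YX.
  - by move=> a Ja; exists X0 => //; case: gX0 => _ JX _; apply: JX.
  - move=> a [X FX Xa]; case: (FP _ FX) => [X00|[_ _]]; last exact.
    by rewrite X00 in Xa.
case: PA => [A0|[Ai JA AS]].
  exfalso; apply: (Amax J); last by right; split.
  by rewrite A0; split=> // /(_ _ (subm0 (M := R^o) Ji)).
exists A; split=> // P' P'i AP' P'S; apply: contrapT => nsub.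
apply: (Amax P'); first by split.
by right; split=> // a /JA /AP'.
Qed.

(** Maximality outside the multiplicative set [S] forces primality: for [a] and [b] outside the
    ideal, enlarging it by each yields two elements of [S], whose product is back in the ideal if
    [a * b] is. *)
Lemma prime_avoiding J (S : set R) : ideal J -> (forall a, J a -> ~ S a) ->
  S 1 -> (forall a b, S a -> S b -> S (a * b)) ->
  exists P, [/\ prime_ideal P, J `<=` P & forall a, P a -> ~ S a].
Proof.
move=> Ji JS S1 SM; have [P [Pi JP PS Pmax]] := maximal_avoiding Ji JS.
exists P; split=> //; apply/prime_idealP; split=> //.
  by move=> /PS; apply.
have meet a : ~ P a -> exists r p, P p /\ S (r * a + p).
  move=> nPa; apply: contrapT => noS; apply: nPa.
  pose Pa : set R := [set r * a + p | r in setT & p in P].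
  have PaE x : Pa x <-> exists r p, P p /\ x = r * a + p.
    split; first by case=> r _ [p Pp <-]; exists r, p.
    by case=> r [p [Pp ->]]; exists r => //; exists p.
  apply: (Pmax Pa).
  - apply/(@submoduleP R R^o); split.
      apply/PaE; exists 0, 0; rewrite mul0r addr0; split=> //.
      exact: (subm0 (M := R^o)).
    move=> c _ _ /PaE[r [p [Pp ->]]] /PaE[r' [p' [Pp' ->]]].
    apply/PaE; exists (c * r + r'), (c * p + p'); split.
      by apply: (submD (M := R^o)) => //; apply: (submZ (M := R^o)).
    rewrite -[c *: _]/(c * _); ring.
  - by move=> p Pp; apply/PaE; exists 0, p; rewrite mul0r add0r.
  - by move=> x /PaE[r [p [Pp ->]]] Sx; apply: noS; exists r, p.
  - apply/PaE; exists 1, 0; rewrite mul1r addr0; split=> //.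
    exact: (subm0 (M := R^o)).
move=> a b Pab; apply: contrapT => /not_orP[/meet[r [p [Pp Sa]]]].
move=> /meet[r' [p' [Pp' Sb]]]; apply: PS (SM _ _ Sa Sb).
have -> : (r * a + p) * (r' * b + p') =
  (r * r') * (a * b) + ((r' * b + p') * p + (r * a) * p') by ring.
apply: (submD (M := R^o)) => //; first exact: (submZ (M := R^o)).
by apply: (submD (M := R^o)) => //; apply: (submZ (M := R^o)).
Qed.

Variable m : set R.
Hypothesis localR : local_ring m.

Lemma local_ideal : ideal m.
Proof. by case: localR => -[/proper_idealP[]]. Qed.

Lemma local_proper : ~ m 1.
Proof. by case: localR => -[/proper_idealP[]]. Qed.

Lemma proper_sub_local J : ideal J -> ~ J 1 -> J `<=` m.
Proof.
move=> Ji J1; have [|P [Pi JP P1 Pmax]] := @maximal_avoiding J [set 1] Ji.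
  by move=> a Ja a1; apply: J1; rewrite -a1.
suff <- : P = m by [].
case: localR => _; apply; split.
  by apply/proper_idealP; split=> // P11; apply: (P1 1).
move=> K /proper_idealP[Ki K1] PK; apply/seteqP; split=> //.
by apply: Pmax => // a Ka a1; apply: K1; rewrite -a1.
Qed.

Lemma local_unit a : ~ m a -> exists b, b * a = 1.
Proof.
move=> ma; apply: contrapT => nb; apply: ma.
apply: (@proper_sub_local [set b * a | b in setT]); last by exists 1; rewrite ?mul1r.
  apply/(@submoduleP R R^o); split; first by exists 0; rewrite ?mul0r.
  move=> c _ _ [b _ <-] [b' _ <-]; exists (c * b + b') => //.
  by rewrite -[c *: _]/(c * _); ring.
by case=> b _ ba; apply: nb; exists b.
Qed.

Lemma local_prime : prime_ideal m.
Proof.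
apply/prime_idealP; split; [exact: local_ideal | exact: local_proper |].
move=> a b mab; apply: contrapT => /not_orP[/local_unit[c ca] /local_unit[e eb]].
apply: local_proper; have -> : 1 = (c * e) * (a * b).
  by rewrite mulrACA ca eb mulr1.
exact: (submZ (M := R^o) _ local_ideal).
Qed.

(** Generators are discarded one at a time. If the span Z of [s] lies in [B] plus the span of
    [e :: s'], inserting this into m Z gives e = c e + w with c in [m] and w in [B] plus the span of
    [s']; as 1 - c is a unit, e is redundant. *)
Lemma nakayama (M : lmodType R) (s : seq M) (B : set M) : submodule B ->
  submod_gen [set` s] `<=` addm B (smul m (submod_gen [set` s])) ->
  submod_gen [set` s] `<=` B.
Proof.
move=> Bs; set Z := submod_gen _ => ZB.
suff H (s' : seq M) : [set` s'] `<=` Z -> Z `<=` addm B (submod_gen [set` s']) -> Z `<=` B.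
  exact: (H s (@sub_submod_gen _ _ _) (@sub_addmr _ _ _ _ Bs)).
elim: s' => [_ H|e s' IHs sZ H].
  apply: (subset_trans H); apply: addm_sub => // u /submod_gen_nil ->.
  exact: subm0.
apply: IHs => [u su|]; first by apply: sZ; rewrite /= inE [_ \in _]su orbT.
have Gs := submodule_gen [set` s']; have BGs := submodule_addm Bs Gs.
pose W : set M := [set u | exists c w, [/\ m c,
  addm B (submod_gen [set` s']) w & u = c *: e + w]].
have Ws : submodule W.
  apply/submoduleP; split.
    exists 0, 0; split; [exact: (subm0 (M := R^o) local_ideal) | exact: subm0 |].
    by rewrite scale0r addr0.
  move=> a _ _ [c [w [mc Ww ->]]] [c' [w' [mc' Ww' ->]]].
  exists (a * c + c'), (a *: w + w'); split.
  - apply: (submD (M := R^o) local_ideal) => //.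
    exact: (submZ (M := R^o) _ local_ideal).
  - by apply: submD => //; apply: submZ.
  - by rewrite scalerDr scalerDl scalerA addrACA.
have ZW : Z `<=` W.
  apply: (subset_trans ZB); apply: addm_sub => //.
    move=> b Bb; exists 0, b; rewrite scale0r add0r; split=> //.
      exact: (subm0 (M := R^o) local_ideal).
    exact: sub_addml.
  apply: smul_sub => // a u ma /H /addmP[b [w [Bb /submod_gen_cons[c [t [st ->]]] ->]]].
  exists (a * c), (a *: (b + t)); split.
  - by rewrite mulrC; apply: (submZ (M := R^o) _ local_ideal).
  - by apply: submZ => //; apply/addmP; exists b, t.
  - by rewrite addrCA scalerDr scalerA.
have [c [w [mc Ww ew]]] : W e by apply: ZW; apply: sZ; exact: mem_head.
have [b bE] : exists b, b * (1 - c) = 1.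
  apply: local_unit => m1c; apply: local_proper.
  by rewrite -(subrK c 1); apply: (submD (M := R^o) local_ideal).
have Be : addm B (submod_gen [set` s']) e.
  rewrite -[e]scale1r -bE -scalerA; apply: submZ => //.
  by rewrite scalerBl scale1r {1}ew addrAC subrr add0r.
apply: (subset_trans H); apply: addm_sub => //; first exact: sub_addml.
move=> _ /submod_gen_cons[a [t [st ->]]]; apply: submD => //; first exact: submZ.
exact: sub_addmr.
Qed.

End Local.

(** * Noetherian rings *)

Section Noetherian.
Variable R : comNzRingType.
Hypothesis noethR : noetherian R.

(** Induction on the generators of the ambient module. The coefficients of [e] in members of [N]
    form an ideal; lifts to [N] of its generators, together with generators of the part of [N] in
    the span of [s], generate [N]. *)
Lemma noetherian_submodule (M : lmodType R) (s : seq M) (N : set M) :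
  submodule N -> N `<=` submod_gen [set` s] ->
  exists t : seq M, N = submod_gen [set` t].
Proof.
elim: s N => [|e s IHs] N Ns Ngen.
  exists [::]; apply/seteqP; split=> // u /submod_gen_nil ->; exact: subm0.
have Gs := submodule_gen [set` s].
pose J : set R := [set c | exists t, submod_gen [set` s] t /\ N (c *: e + t)].
have [|js Jjs] := noethR (J := J).
  apply/(@submoduleP R R^o); split.
    by exists 0; rewrite scale0r addr0; split; apply: subm0.
  move=> a c c' [t [st Nt]] [t' [st' Nt']]; exists (a *: t + t'); split.
    by apply: (submD Gs) => //; apply: (submZ _ Gs).
  rewrite scalerDl -[X in X + _ + _]scalerA addrACA -scalerDr.
  by apply: submD => //; apply: submZ.
have [vs [vsN vsJ]] : exists vs : seq M, [set` vs] `<=` N /\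
    forall c, ideal_gen [set` js] c ->
      exists2 v, submod_gen [set` vs] v & submod_gen [set` s] (v - c *: e).
  have: [set` js] `<=` J by rewrite Jjs; apply: (@sub_submod_gen R R^o).
  elim: js {Jjs} => [_|j js IHj jJ].
    exists [::]; split=> // c /(@submod_gen_nil R R^o) ->.
    by exists 0; rewrite ?scale0r ?subr0; apply: subm0 => //; apply: submodule_gen.
  have [|vs [vsN vsJ]] := IHj.
    by move=> c jc; apply: jJ; rewrite /= inE [_ \in _]jc orbT.
  have [t [st Nt]] : J j by apply: jJ; rewrite /= mem_head.
  exists ((j *: e + t) :: vs); split.
    by move=> u /=; rewrite inE => /orP[/eqP ->|/vsN].
  move=> _ /(@submod_gen_cons R R^o)[c [c' [/vsJ[v vsv sv] ->]]].
  exists (c *: (j *: e + t) + v).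
    by apply/submod_gen_cons; exists c, v.
  rewrite scalerDl scalerDr -[(c *: (j : R^o)) *: e]/((c * j) *: e) -scalerA opprD.
  rewrite (_ : _ + (- _ - _) = c *: t + (v - c' *: e)); last first.
    by rewrite addrACA [_ + c *: t]addrC addrK.
  by apply: (submD Gs) => //; apply: (submZ _ Gs).
have [|u [] //|ts Nts] := IHs (N `&` submod_gen [set` s]).
  exact: submoduleI.
exists (vs ++ ts); apply/seteqP; split; last first.
  apply: submod_gen_sub => // u /=; rewrite mem_cat => /orP[/vsN //|tu].
  suff [] : (N `&` submod_gen [set` s]) u by [].
  by rewrite Nts; apply: sub_submod_gen.
move=> u Nu; have /submod_gen_cons[c [t [st uE]]] := Ngen _ Nu.
have [|v vsv sv] := vsJ c; first by rewrite -Jjs; exists t; rewrite -uE.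
have Nv : N v by move: v vsv {sv}; apply: submod_gen_sub.
have: (N `&` submod_gen [set` s]) (u - v).
  split; first exact: submB.
  rewrite (_ : u - v = t - (v - c *: e)); last by rewrite uE opprB addrA [c *: e + t]addrC.
  exact: (submB Gs).
rewrite Nts => tuv; rewrite -(subrK v u).
apply: (submD (submodule_gen [set` vs ++ ts])).
- by move: tuv; apply: submod_genS => w /=; rewrite mem_cat orbC => ->.
- by move: vsv; apply: submod_genS => w /=; rewrite mem_cat => ->.
Qed.

End Noetherian.

(** * The Koszul complex *)

Section Koszul.
Variables (R : comNzRingType) (M : lmodType R).
Implicit Types (N : set M) (x a : R) (xs : seq R) (n i k : nat).

(* The total space of the Koszul complex on [n] elements with coefficients in
   [M], as an iterated mapping cone. *)
Fixpoint koszul n : lmodType R :=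
  if n is n'.+1 then (koszul n' * koszul n')%type : lmodType R else M.

(** The cone of multiplication by [x]: the second component is the shifted copy, and its sign makes
    the differential square to zero. *)
Fixpoint koszul_d xs : koszul (size xs) -> koszul (size xs) :=
  if xs is x :: xs' then fun z : koszul (size xs') * koszul (size xs') =>
    (koszul_d z.1 + x *: z.2, - koszul_d z.2)
  else fun=> 0.

(** Graded pieces are submodules of one total space, so differentials and homotopies keep a single
    type and degrees become side conditions. *)
Fixpoint koszul_deg n i : set (koszul n) :=
  if n is n'.+1 then [set z : koszul n' * koszul n' |
    koszul_deg i z.1 /\ (if i is j.+1 then koszul_deg j z.2 else z.2 = 0)]
  else [set z | i = 0%N \/ z = 0].

(** The kernel of the passage to the Koszul complex of M/N; membership plays the role of being zero
    with coefficients in M/N. *)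
Fixpoint koszul_in n N : set (koszul n) :=
  if n is n'.+1 then [set z : koszul n' * koszul n' |
    koszul_in N z.1 /\ koszul_in N z.2]
  else N.

Lemma submodule_koszul_in n N : submodule N -> submodule (koszul_in (n := n) N).
Proof.
move=> Ns; elim: n => //= n IHn; apply/submoduleP; split.
  by split; apply: subm0.
by move=> a u v [? ?] [? ?]; split; apply: (submD IHn) => //;
  apply: (submZ _ IHn).
Qed.

Lemma submodule_koszul_deg n i : submodule (koszul_deg (n := n) i).
Proof.
elim: n i => [|n IHn] i /=; apply/submoduleP; split.
- by right.
- by move=> a u v [?|->] [?|->]; by [left | right; rewrite scaler0 addr0].
- by split; [|case: i => // i]; apply: subm0.
- move=> a u v [u1 ui] [v1 vi]; split.
    by apply: (submD (IHn i)) => //; apply: (submZ _ (IHn i)).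
  case: i {u1 v1} ui vi => [/= -> ->|i ? ?]; first by rewrite scaler0 addr0.
  by apply: (submD (IHn i)) => //; apply: (submZ _ (IHn i)).
Qed.

Lemma koszul_deg_gt n i (z : koszul n) : (n < i)%N -> koszul_deg i z -> z = 0.
Proof.
elim: n i z => [|n IHn] i; first by move=> z; case: i => // i _ [].
move=> [u v]; case: i => // i ni [/= ui vi].
have -> : u = 0 by apply: (IHn i.+1) => //; apply: ltnW.
by have -> : v = 0 by apply: (IHn i).
Qed.

Lemma koszul_dP xs b (z w : koszul (size xs)) :
  koszul_d (b *: z + w) = b *: koszul_d z + koszul_d w.
Proof.
elim: xs z w => [|x xs IH] z w /=; first by rewrite scaler0 addr0.
rewrite !IH; congr pair; last by rewrite /= opprD scalerN.
by rewrite /= !scalerDr !scalerA [x * b]mulrC -!scalerA addrACA.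
Qed.

Lemma koszul_d0 xs : koszul_d (0 : koszul (size xs)) = 0.
Proof.
by have := koszul_dP (-1) (0 : koszul (size xs)) 0; rewrite scaler0 addr0 scaleN1r addNr.
Qed.

Lemma koszul_dZ xs b (z : koszul (size xs)) : koszul_d (b *: z) = b *: koszul_d z.
Proof. by rewrite -[b *: z]addr0 koszul_dP koszul_d0 addr0. Qed.

Lemma koszul_dD xs (z w : koszul (size xs)) :
  koszul_d (z + w) = koszul_d z + koszul_d w.
Proof. by rewrite -[z]scale1r koszul_dP !scale1r. Qed.

Lemma koszul_dN xs (z : koszul (size xs)) : koszul_d (- z) = - koszul_d z.
Proof. by rewrite -scaleN1r koszul_dZ scaleN1r. Qed.

Lemma koszul_dd xs (z : koszul (size xs)) : koszul_d (koszul_d z) = 0.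
Proof.
elim: xs z => //= x xs IH z; rewrite koszul_dN IH !oppr0 koszul_dD IH koszul_dZ.
by rewrite add0r scalerN addrN.
Qed.

Lemma koszul_d_deg0 xs (z : koszul (size xs)) :
  koszul_deg 0 z -> koszul_d z = 0.
Proof.
elim: xs z => [//|y xs IH] [v w] /= [v0 ->].
by rewrite koszul_d0 oppr0 IH // scaler0 addr0.
Qed.

Lemma koszul_d_deg xs i (z : koszul (size xs)) :
  koszul_deg i.+1 z -> koszul_deg i (koszul_d z).
Proof.
elim: xs i z => [|x xs IH] i; first by move=> z _; right.
case=> u v [/= ui vi]; split.
  apply: (submD (submodule_koszul_deg _ i)); first exact: IH.
  exact: (submZ _ (submodule_koszul_deg _ i)).
case: i ui vi => [_ v0|i _ vi] /=; first by rewrite koszul_d_deg0 ?oppr0.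
by apply: (submN (submodule_koszul_deg _ i)); apply: IH.
Qed.

Lemma koszul_d_in xs N (z : koszul (size xs)) : submodule N ->
  koszul_in N z -> koszul_in N (koszul_d z).
Proof.
move=> Ns; elim: xs z => [|x xs IH] z /=; first by move=> _; apply: subm0.
have Ks := submodule_koszul_in (size xs) Ns.
case=> z1 z2; split; last by apply: (submN Ks); apply: IH.
by apply: (submD Ks); [apply: IH | apply: (submZ _ Ks)].
Qed.

Lemma koszul_in_addm n N a i (z : koszul n) : submodule N -> koszul_deg i z ->
  koszul_in (addm N (scalem a setT)) z ->
  exists w, koszul_deg i w /\ koszul_in N (z - a *: w).
Proof.
move=> Ns; elim: n i z => [|n IHn] i.
  move=> z /= [->|->].
    move=> [u Nu [_ [v _ <-] <-]]; exists v; split; first by left.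
    by rewrite addrK.
  by move=> _; exists 0; split; [right | rewrite scaler0 subr0; apply: subm0].
case=> u v /= [ui vi] [/(IHn _ _ ui)[u' [ui' uN]] vN].
case: i {ui} ui' vi => [|i] ui' vi.
  exists (u', 0); split=> //; split=> //=; rewrite vi scaler0 subr0.
  exact: (subm0 (submodule_koszul_in _ Ns)).
by have [v' [? ?]] := IHn _ _ vi vN; exists (u', v').
Qed.

Lemma koszul_in_reg n N a (z : koszul n) : (forall u, N (a *: u) -> N u) ->
  koszul_in N (a *: z) -> koszul_in N z.
Proof.
by move=> Na; elim: n z => [|n IHn] z /=; [apply: Na | case=> /IHn ? /IHn].
Qed.

(** These homotopies make the ideal of [xs] annihilate Koszul homology. Raising the degree gives
    this degree by degree, and preserving every [koszul_in N] gives it for coefficients in each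
    M/N. *)
Lemma koszul_homotopy xs a : ideal_gen [set` xs] a ->
  exists h : koszul (size xs) -> koszul (size xs),
  [/\ forall b z w, h (b *: z + w) = b *: h z + h w,
      forall i z, koszul_deg i z -> koszul_deg i.+1 (h z),
      forall N z, submodule N -> koszul_in N z -> koszul_in N (h z) &
      forall z, koszul_d (h z) + h (koszul_d z) = a *: z].
Proof.
pose H xs a h := [/\ forall b z w, h (b *: z + w) = b *: h z + h w,
      forall i z, koszul_deg i z -> koszul_deg i.+1 (h z),
      forall N z, submodule N -> koszul_in N z -> koszul_in N (h z) &
      forall z : koszul (size xs), koszul_d (h z) + h (koszul_d z) = a *: z].
pose J xs : set R := [set a | exists h, H xs a h].
(* Homotopies combine linearly, so the elements that admit one form an ideal and only the entries of
   [xs] remain. *)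
suff xsJ x : x \in xs -> J xs x.
  move: a; apply: (@submod_gen_sub R R^o _ (J xs)) => //.
  apply/(@submoduleP R R^o); split.
    exists (fun=> 0); split=> [b z w|i z _|N z Ns _|z].
    - by rewrite scaler0 addr0.
    - exact: (subm0 (submodule_koszul_deg _ _)).
    - exact: (subm0 (submodule_koszul_in _ Ns)).
    - by rewrite koszul_d0 addr0 scale0r.
  move=> c a b [h [hl hd hi ha]] [g [gl gd gi gb]].
  exists (fun z => c *: h z + g z); split=> [e z w|i z zi|N z Ns zN|z].
  - by rewrite hl gl !scalerDr !scalerA [c * e]mulrC -!scalerA addrACA.
  - have Ds := submodule_koszul_deg (size xs) i.+1.
    by apply: (submD Ds); [apply: (submZ _ Ds); apply: hd | apply: gd].
  - have Ks := submodule_koszul_in (size xs) Ns.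
    by apply: (submD Ks); [apply: (submZ _ Ks); apply: hi | apply: gi].
  - rewrite koszul_dP addrACA -scalerDr ha gb scalerDl.
    by rewrite -[(c *: (a : R^o)) *: z]/((c * a) *: z) scalerA.
elim: xs x => [//|y xs IH] x; rewrite inE => /orP[/eqP ->|/IH[h [hl hd hi ha]]].
  (* For the head, the homotopy moves the first component into the shifted copy, and the cone
     differential returns it multiplied by [y]. *)
  exists (fun z : koszul (size xs) * koszul (size xs) => (0, z.1)).
  split=> [b z w|i z|N z Ns|z].
  - by congr pair; rewrite /= ?scaler0 ?addr0.
  - by case=> z1i _; split=> //; apply: (subm0 (submodule_koszul_deg _ _)).
  - by case=> z1N _; split=> //; apply: (subm0 (submodule_koszul_in _ Ns)).
  - rewrite /= koszul_d0 add0r; congr pair; rewrite /= ?addr0 //.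
    by rewrite addrA addNr add0r.
have h0 : h 0 = 0.
  by have := hl (-1) 0 0; rewrite scaler0 addr0 scaleN1r addNr.
have hN z : h (- z) = - h z.
  by have := hl (-1) z 0; rewrite !addr0 h0 addr0 !scaleN1r.
have hD z w : h (z + w) = h z + h w by rewrite -[z]scale1r hl !scale1r.
exists (fun z : koszul (size xs) * koszul (size xs) => (h z.1, - h z.2)).
split=> [b z w|i z [z1 z2]|N z Ns [z1 z2]|z].
- by congr pair; rewrite /= hl ?opprD ?scalerN.
- split; first exact: hd.
  case: i z1 z2 => [|i] z1 z2 /=.
    rewrite z2 h0 oppr0; exact: (subm0 (submodule_koszul_deg _ _)).
  by apply: (submN (submodule_koszul_deg _ _)); apply: hd.
- split; first exact: hi.
  by apply: (submN (submodule_koszul_in _ Ns)); apply: hi.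
- rewrite /= hD koszul_dN hN !opprK; congr pair; rewrite /= -?ha //.
  have -> : h (y *: z.2) = y *: h z.2 by rewrite -[y *: z.2]addr0 hl h0 addr0.
  by rewrite scalerN addrACA addNr addr0.
Qed.

(* Vanishing of the homology in degree [i] with coefficients in M / N. *)
Definition koszul_exact xs N i := forall z : koszul (size xs),
  koszul_deg i z -> koszul_in N (koszul_d z) ->
  exists w, koszul_deg i.+1 w /\ koszul_in N (z - koszul_d w).

(* Since [a ^+ k] kills the homology of degree i mod N, it suffices that
   [a] acts injectively on it. *)
Lemma koszul_exact_descent xs N i a k : submodule N ->
  (forall u, N (a *: u) -> N u) -> ideal_gen [set` xs] (a ^+ k) ->
  koszul_exact xs (addm N (scalem a setT)) i.+1 -> koszul_exact xs N i.
Proof.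
move=> Ns Na xsa ex.
have Ks := submodule_koszul_in (size xs) Ns.
have Naxs : submodule (addm N (scalem a setT)).
  by apply: submodule_addm => //; apply/submodule_scalem/submoduleT.
have Kas := submodule_koszul_in (size xs) Naxs.
(* The connecting map in disguise. If a z = d w modulo N, then w is a cycle modulo N + aM, so w = d
   v + a w' modulo N by exactness one degree up. Applying d gives a z = a d w' modulo N, and [a]
   cancels. *)
have inj (z w : koszul (size xs)) : koszul_deg i.+1 w -> koszul_in N (a *: z - koszul_d w) ->
    exists w', koszul_deg i.+1 w' /\ koszul_in N (z - koszul_d w').
  move=> wi azw.
  have KNN n (y : koszul n) : koszul_in N y -> koszul_in (addm N (scalem a setT)) y.
    elim: n y => [|n IHn] y /=; last by case=> /IHn ? /IHn.
    exact/sub_addml/submodule_scalem/submoduleT.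
  have Kaz n (y : koszul n) : koszul_in (addm N (scalem a setT)) (a *: y).
    elim: n y => [|n IHn] y /=; last by split.
    by apply: sub_addmr => //; exists y.
  have dwN : koszul_in (addm N (scalem a setT)) (koszul_d w).
    exact: (submBl Kas (KNN _ _ azw) (Kaz _ z)).
  have [v [vi wv]] := ex w wi dwN.
  have wvi : koszul_deg i.+1 (w - koszul_d v).
    apply: (submB (submodule_koszul_deg _ _)) => //; exact: koszul_d_deg.
  have [w' [w'i]] := koszul_in_addm Ns wvi wv.
  move=> /(koszul_d_in Ns); rewrite koszul_dD !koszul_dN koszul_dD koszul_dN.
  rewrite koszul_dd oppr0 addr0 koszul_dZ => dw.
  exists w'; split=> //; apply: (koszul_in_reg Na).
  have := submD Ks azw dw.
  by rewrite addrA subrK scalerBr.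
have [h [hl hd hi ha]] := koszul_homotopy xsa.
move=> z zi zN.
have : exists w, koszul_deg i.+1 w /\ koszul_in N (a ^+ k *: z - koszul_d w).
  exists (h z); split; first exact: hd.
  by rewrite -ha addrC addKr; apply: hi.
elim: k {xsa ha} => [|k IHk]; first by rewrite expr0 scale1r.
rewrite exprS -scalerA => -[w [wi]] /(inj _ _ wi) => E; exact: IHk.
Qed.

(** Weak regularity on M/N, passing to N + aM as the descent on Koszul homology does. Properness of
    the last quotient is a separate hypothesis of [regular_prime_chain]. *)
Fixpoint regular_mod N (s : seq R) : Prop :=
  if s is a :: s' then
    (forall u, N (a *: u) -> N u) /\ regular_mod (addm N (scalem a setT)) s'
  else True.

(** Above degree [size xs] the complex is zero, and each entry of [s] brings the vanishing down by
    one degree; the inequality says that [s] is long enough to reach [i]. *)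
Lemma koszul_exact_regular xs N i (s : seq R) : submodule N ->
  regular_mod N s -> (forall a, a \in s -> radical (ideal_gen [set` xs]) a) ->
  (size xs < i + size s)%N -> koszul_exact xs N i.
Proof.
elim: s N i => [|a s IHs] N i Ns /=.
  rewrite addn0 => _ _ xsi z /(koszul_deg_gt xsi) -> _.
  exists 0; rewrite koszul_d0 subr0; split.
    exact: (subm0 (submodule_koszul_deg _ _)).
  exact: (subm0 (submodule_koszul_in _ Ns)).
case=> Na Ns' sQ; rewrite addnS -addSn => xsi.
have [k ak] : radical (ideal_gen [set` xs]) a by apply: sQ; rewrite mem_head.
apply: (koszul_exact_descent Ns Na ak); apply: IHs => //.
  by apply: submodule_addm => //; apply/submodule_scalem/submoduleT.
by move=> b sb; apply: sQ; rewrite inE sb orbT.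
Qed.

End Koszul.

(** * Products of ideals with submodules, and their powers *)

Section Smul.
Variables (R : comNzRingType) (M : lmodType R).
Implicit Types (N K L U V : set M) (J : set R) (u v : M) (a b x : R) (xs : seq R).

Lemma smul_gen_nil N : smul (ideal_gen [set` [::]]) N = [set 0].
Proof.
apply/seteqP; split=> [|_ ->]; last exact: (subm0 (submodule_smul _ _)).
by apply: smul_gen_sub; [exact: submodule0 | move=> a u].
Qed.

Lemma smul_gen_cons x xs N : submodule N ->
  smul (ideal_gen [set` x :: xs]) N =
  addm (scalem x N) (smul (ideal_gen [set` xs]) N).
Proof.
move=> Ns; have xNs := submodule_scalem x Ns; apply/seteqP; split.
  apply: smul_gen_sub.
    by apply: submodule_addm => //; apply: submodule_smul.
  move=> a u /=; rewrite inE => /orP[/eqP ->|xsa] Nu.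
    by apply: (sub_addml (submodule_smul _ _)); exists u.
  apply: (sub_addmr xNs); apply: smulM => //.
  exact: (@sub_submod_gen R R^o).
apply: addm_sub; first exact: submodule_smul.
  move=> _ [u Nu <-]; apply: smulM => //; apply: (@sub_submod_gen R R^o).
  exact: mem_head.
apply: smulS => //; apply: (@submod_genS R R^o) => a /= xsa.
by rewrite inE xsa orbT.
Qed.

Lemma addmC N K : addm N K = addm K N.
Proof.
by apply/seteqP; split=> _ [u Nu [v Kv <-]]; apply/addmP; exists v, u;
  rewrite addrC.
Qed.

Lemma smul_gen_rcons x xs N : submodule N ->
  smul (ideal_gen [set` rcons xs x]) N =
  addm (smul (ideal_gen [set` xs]) N) (scalem x N).
Proof.
move=> Ns; rewrite addmC -smul_gen_cons //; congr (smul (ideal_gen _) N).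
by apply/seteqP; split=> a /=; rewrite mem_rcons.
Qed.

Lemma smul_addm J N K : submodule N -> submodule K ->
  smul J (addm N K) = addm (smul J N) (smul J K).
Proof.
move=> Ns Ks; apply/seteqP; split.
  apply: smul_sub; first by apply: submodule_addm; apply: submodule_smul.
  move=> a _ Ja [u Nu [v Kv <-]]; apply/addmP; exists (a *: u), (a *: v).
  by rewrite scalerDr; split=> //; apply: smulM.
apply: addm_sub; first exact: submodule_smul.
  by apply: smulS => //; apply: sub_addml.
by apply: smulS => //; apply: sub_addmr.
Qed.

Lemma smul_scalem J x N : smul J (scalem x N) = scalem x (smul J N).
Proof.
apply/seteqP; split.
  apply: smul_sub; first exact/submodule_scalem/submodule_smul.
  move=> a _ Ja [u Nu <-]; exists (a *: u); first exact: smulM.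
  by rewrite !scalerA mulrC.
move=> _ [u Nu <-]; move: u Nu.
apply: (smul_sub (K := [set u | smul J (scalem x N) (x *: u)])).
  exact/submodule_scale_preim/submodule_smul.
move=> a u Ja Nu /=; rewrite scalerA mulrC -scalerA.
by apply: smulM => //; exists u.
Qed.

Lemma smulC J J' N : smul J (smul J' N) = smul J' (smul J N).
Proof.
suff H (K K' : set R) : smul K (smul K' N) `<=` smul K' (smul K N) by apply/seteqP; split.
apply: smul_sub; first exact: submodule_smul.
move=> a u Ka; move: u.
apply: (smul_sub (K := [set u | smul K' (smul K N) (a *: u)])).
  exact/submodule_scale_preim/submodule_smul.
move=> b u Kb Nu /=; rewrite scalerA mulrC -scalerA.
by apply: smulM => //; apply: smulM.
Qed.

Lemma smul_ideal_mul J J' N : smul (ideal_mul J J') N = smul J (smul J' N).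
Proof.
apply/seteqP; split.
  apply: smul_sub; first exact: submodule_smul.
  move=> a u Ja Nu; move: a Ja.
  apply: (smul_sub (M := R^o) (K := [set a : R | smul J (smul J' N) (a *: u)])).
    exact/ideal_preim/submodule_smul.
  move=> a b Ja Jb; rewrite /= -[a *: b]/(a * b) -scalerA.
  by apply: smulM => //; apply: smulM.
apply: smul_sub; first exact: submodule_smul.
move=> a u Ja; move: u.
apply: (smul_sub (K := [set u | smul (ideal_mul J J') N (a *: u)])).
  exact/submodule_scale_preim/submodule_smul.
move=> b u Jb Nu /=; rewrite scalerA; apply: smulM => //.
exact: (smulM (M := R^o)).
Qed.

Lemma smul_ideal_exp J n N : submodule N ->
  smul (ideal_exp J n) N = iter n (smul J) N.
Proof.
move=> Ns; elim: n => [|n IHn].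
  apply/seteqP; split; first exact: smul_subr.
  by move=> u Nu; rewrite -[u]scale1r; apply: smulM.
by rewrite /ideal_exp /= smul_ideal_mul -/(ideal_exp J n) IHn.
Qed.

Lemma submodule_iter_smul J n N : submodule N -> submodule (iter n (smul J) N).
Proof. by move=> Ns; case: n => //= n; apply: submodule_smul. Qed.

Lemma iter_smulS J n N K : N `<=` K -> iter n (smul J) N `<=` iter n (smul J) K.
Proof. by move=> NK; elim: n => //= n IHn; apply: smulS. Qed.

Lemma iter_smul_scalem J n x N :
  iter n (smul J) (scalem x N) = scalem x (iter n (smul J) N).
Proof. by elim: n => //= n ->; rewrite smul_scalem. Qed.

Lemma iter_smulSl J J' n N : J `<=` J' ->
  iter n (smul J) N `<=` iter n (smul J') N.
Proof. by move=> JJ; elim: n => //= n IHn; apply: smulS. Qed.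

(** A monomial of degree [n.+1] either contains [x] or involves only [xs]. *)
Lemma iter_smul_cons x xs n N : submodule N ->
  iter n.+1 (smul (ideal_gen [set` x :: xs])) N =
  addm (scalem x (iter n (smul (ideal_gen [set` x :: xs])) N))
       (iter n.+1 (smul (ideal_gen [set` xs])) N).
Proof.
move=> Ns; elim: n => [|n IHn]; first exact: smul_gen_cons.
rewrite iterS smul_gen_cons; last exact: submodule_iter_smul.
set Qn1 := iter n.+1 _ N in IHn *; rewrite {2}IHn.
set Qn := iter n _ N in IHn *.
have Qns : submodule Qn by apply: submodule_iter_smul.
rewrite smul_addm; [|exact: submodule_scalem|exact: submodule_iter_smul].
rewrite smul_scalem -iterS; set A := iter n.+2 _ N.
have As : submodule A by apply: submodule_iter_smul.
have Qn1s : submodule Qn1 by apply: submodule_iter_smul.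
have xQs := submodule_scalem x Qn1s.
apply/seteqP; split; apply: addm_sub; try exact: submodule_addm.
- exact: sub_addml.
- apply: addmS => //; apply: scalemS; rewrite /Qn1 iterS; apply: smulS => //.
  by apply: (@submod_genS R R^o) => a /= xsa; rewrite inE xsa orbT.
- apply: submodule_addm => //; apply: submodule_addm => //.
  exact/submodule_scalem/submodule_smul.
- apply: sub_addml; apply: submodule_addm => //.
  exact/submodule_scalem/submodule_smul.
- move=> u Au; apply: (sub_addmr xQs); apply: sub_addmr => //.
  exact/submodule_scalem/submodule_smul.
Qed.

(* Weak regularity with the head of the list coming last. *)
Fixpoint regular_rev xs : Prop :=
  if xs is x :: xs' then
    (forall u, smul (ideal_gen [set` xs']) [set: M] (x *: u) ->
               smul (ideal_gen [set` xs']) [set: M] u) /\ regular_rev xs'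
  else True.

End Smul.

(** * From vanishing of H_1 to regularity *)

Section KoszulRegular.
Variables (R : comNzRingType) (M : lmodType R).
Implicit Types (u v : M) (xs : seq R).

Fixpoint koszul_inj n (u : M) : koszul M n :=
  if n is n'.+1 then (koszul_inj n' u, 0) else u.

Lemma koszul_inj_inj n : injective (koszul_inj n).
Proof. by elim: n => //= n IHn u v [/IHn]. Qed.

Lemma koszul_injP n a u v :
  koszul_inj n (a *: u + v) = a *: koszul_inj n u + koszul_inj n v.
Proof.
by elim: n => //= n ->; congr pair; rewrite /= scaler0 addr0.
Qed.

Lemma koszul_inj0 n : koszul_inj n 0 = 0.
Proof. by elim: n => //= n ->. Qed.

Lemma koszul_deg_inj n u : koszul_deg 0 (koszul_inj n u).
Proof. by elim: n => //=; left. Qed.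

Lemma koszul_deg0P n (z : koszul M n) :
  koszul_deg 0 z -> exists u, z = koszul_inj n u.
Proof.
elim: n z => [|n IHn] z /=; first by exists z.
by case: z => z1 z2 /= [/IHn[u ->] ->]; exists u.
Qed.

(** With the converse [koszul_d_deg1_surj], this identifies H_0 with M/(xs)M. *)
Lemma koszul_d_deg1 xs (z : koszul M (size xs)) : koszul_deg 1 z ->
  exists2 u, smul (ideal_gen [set` xs]) setT u &
    koszul_d z = koszul_inj (size xs) u.
Proof.
elim: xs z => [|x xs IH] z.
  by move=> _; exists 0 => //; apply: (subm0 (submodule_smul _ _)).
case: z => z1 z2 /= [/IH[u xsu ->] z20].
have [v z2E] := koszul_deg0P z20; exists (x *: v + u).
  rewrite smul_gen_cons; last exact: submoduleT.
  by apply/addmP; exists (x *: v), u; split=> //; exists v.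
by rewrite koszul_d_deg0 // oppr0 koszul_injP z2E addrC.
Qed.

Lemma koszul_d_deg1_surj xs u : smul (ideal_gen [set` xs]) setT u ->
  exists2 z : koszul M (size xs), koszul_deg 1 z &
    koszul_d z = koszul_inj (size xs) u.
Proof.
elim: xs u => [|x xs IH] u.
  by rewrite smul_gen_nil => ->; exists 0 => //; right.
rewrite smul_gen_cons; last exact: submoduleT.
case=> _ [v _ <-] [w /IH[z zi zE] <-].
exists (z, koszul_inj (size xs) v).
  by split=> //; apply: koszul_deg_inj.
rewrite /= koszul_injP zE koszul_d_deg0 ?oppr0 1?addrC //.
exact: koszul_deg_inj.
Qed.

Lemma koszul_in0 n (z : koszul M n) : koszul_in [set 0] z <-> z = 0.
Proof.
elim: n z => //= n IHn [z1 z2] /=; split; first by case=> /IHn -> /IHn ->.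
by case=> -> ->; split; apply/IHn.
Qed.

Lemma koszul_fg n : finitely_generated M -> finitely_generated (koszul M n).
Proof.
move=> fgM; elim: n => //= n [s sT].
pose s' := [seq (e, 0) | e <- s] ++ [seq (0, e) | e <- s]
  : seq (koszul M n * koszul M n).
have Gs := submodule_gen [set` s']; exists s'; apply/seteqP; split=> // -[u v] _.
have -> : (u, v) = (u, 0) + (0, v) by congr pair; rewrite /= ?addr0 ?add0r.
apply: (submD Gs).
  have: [set: koszul M n] u by [].
  rewrite -sT; apply: (@submod_gen_sub _ _ _ [set u | submod_gen [set` s'] (u, 0)]).
    apply/submoduleP; split; first exact: (subm0 Gs).
    move=> a x y /= sx sy.
    have -> : (a *: x + y, 0 : koszul M n) = a *: (x, 0) + (y, 0).
      by congr pair; rewrite /= scaler0 addr0.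
    by apply: (submD Gs) => //; apply: (submZ _ Gs).
  move=> e /= se; apply: sub_submod_gen => /=.
  by rewrite mem_cat map_f.
have: [set: koszul M n] v by [].
rewrite -sT; apply: (@submod_gen_sub _ _ _ [set u | submod_gen [set` s'] (0, u)]).
  apply/submoduleP; split; first exact: (subm0 Gs).
  move=> a x y /= sx sy.
  have -> : (0 : koszul M n, a *: x + y) = a *: (0, x) + (0, y).
    by congr pair; rewrite /= scaler0 addr0.
  by apply: (submD Gs) => //; apply: (submZ _ Gs).
move=> e /= se; apply: sub_submod_gen => /=.
by rewrite mem_cat orbC map_f.
Qed.

Variable m : set R.
Hypotheses (noethR : noetherian R) (localR : local_ring m).
Hypothesis fgM : finitely_generated M.

(** The cone of [x] has the exact sequence H_1(xs) -> H_1(xs) -> H_1(x :: xs) -> H_0(xs) -> H_0(xs),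
    whose outer maps are multiplication by [x] up to sign. When the middle term vanishes, [x] is
    injective on H_0(xs) = M/(xs)M and surjective on H_1(xs), which is then zero by Nakayama's
    lemma. *)
Lemma koszul_exact_regular_rev xs : [set` xs] `<=` m ->
  koszul_exact xs [set (0 : M)] 1 -> regular_rev M xs.
Proof.
elim: xs => //= x xs IH xsm ex; split.
  move=> v /koszul_d_deg1_surj[z zi zE].
  (* Since x v = d z, this is a cycle of the cone. Bounding it exhibits [v] itself as a boundary,
     that is, as a member of (xs)M. *)
  pose y : koszul M (size xs).+1 := (z, - koszul_inj (size xs) v).
  have yi : koszul_deg 1 y.
    by split=> //; apply: (submN (submodule_koszul_deg _ _ _)); apply: koszul_deg_inj.
  have [|[p q] [[/= _ qi] [_ /koszul_in0 E]]] := ex y yi.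
    apply/koszul_in0; rewrite /= zE koszul_dN koszul_d_deg0 ?oppr0; last first.
      exact: koszul_deg_inj.
    congr pair; rewrite -[x *: v]addr0 koszul_injP koszul_inj0 addr0.
    by rewrite scalerN addrN.
  have [u xsu qE] := koszul_d_deg1 qi.
  suff -> : v = u by [].
  apply: (@koszul_inj_inj (size xs)); rewrite -qE.
  by move: E => /= /eqP; rewrite opprK addrC subr_eq0 => /eqP ->.
apply: IH; first by move=> a xsa; apply: xsm; rewrite /= inE [_ \in _]xsa orbT.
pose Z : set (koszul M (size xs)) := [set z | koszul_deg 1 z /\ koszul_d z = 0].
pose B : set (koszul M (size xs)) := [set koszul_d p | p in koszul_deg 2].
have Bs : submodule B.
  apply/submoduleP; split.
    by exists 0; [apply: (subm0 (submodule_koszul_deg _ _ _)) | rewrite koszul_d0].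
  move=> a _ _ [p pi <-] [q qi <-]; exists (a *: p + q); last exact: koszul_dP.
  have Ds := submodule_koszul_deg M (size xs) 2.
  by apply: (submD Ds) => //; apply: (submZ _ Ds).
have Zs : submodule Z.
  have Ds := submodule_koszul_deg M (size xs) 1.
  apply/submoduleP; split; first by split; [apply: subm0 | rewrite koszul_d0].
  move=> a u v [ui u0] [vi v0]; split.
    by apply: (submD Ds) => //; apply: (submZ _ Ds).
  by rewrite koszul_dP u0 v0 scaler0 addr0.
have [s sT] := koszul_fg (size xs) fgM.
have [|t tZ] := noetherian_submodule noethR Zs (s := s); first by rewrite sT.
have ZB : Z `<=` B.
  rewrite tZ; apply: (nakayama localR Bs); rewrite -tZ => z [zi z0].
  (* Bounding the cycle (z, 0) by (p, q) gives z = d p + x q with q again a cycle, so z lies in B +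
     m Z. *)
  have [||[p q] [[/= pi qi] [/koszul_in0/eqP E1 /koszul_in0 E2]]] := ex (z, 0).
  - by split=> //; apply: (subm0 (submodule_koszul_deg _ _ _)).
  - by apply/koszul_in0; rewrite /= z0 koszul_d0 scaler0 oppr0 addr0.
  apply/addmP; exists (koszul_d p), (x *: q); split.
  - by exists p.
  - apply: smulM; first by apply: xsm; apply: mem_head.
    by split=> //; move: E2; rewrite /= opprK add0r.
  - by apply/eqP; rewrite -subr_eq0.
move=> z zi /koszul_in0 z0; have [|p pi pE] := ZB z; first by [].
by exists p; split=> //; apply/koszul_in0; rewrite pE subrr.
Qed.

End KoszulRegular.

(** * Lengths *)

Section Chains.
Variable T : Type.
Implicit Types (F G : set (set T)) (C D : nat -> set T) (k n : nat).

Lemma sup_chain_length_uniq F n n' :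
  sup_chain_length F n -> sup_chain_length F n' -> n = n'.
Proof.
move=> [[C FC] Fn] [[C' FC'] Fn']; apply/eqP; rewrite eqn_leq.
by rewrite (Fn' _ _ FC) (Fn _ _ FC').
Qed.

Lemma sup_chain_length_bounded F n : F !=set0 ->
  (forall k C, chain_in F k C -> (k <= n)%N) -> exists n', sup_chain_length F n'.
Proof.
move=> [A FA] Fn; pose P k := `[< exists C, chain_in F k C >].
have exP : exists k, P k by exists 0%N; apply/asboolP; exists (fun=> A).
have ubP k : P k -> (k <= n)%N by move=> /asboolP[C]; apply: Fn.
case: (ex_maxnP exP ubP) => n' /asboolP[C FC] n'max; exists n'; split.
  by exists C.
by move=> k D FD; apply: n'max; apply/asboolP; exists D.
Qed.

(** Repetitions are deleted, leaving one step per proper inclusion. The last term is tracked because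
    the induction appends to it. *)
Lemma weak_chain F k D : (forall i, (i <= k)%N -> F (D i)) ->
  (forall i, (i < k)%N -> D i `<=` D i.+1) ->
  exists C, chain_in F (\sum_(i < k) ~~ `[< D i.+1 `<=` D i >])%N C /\
    C (\sum_(i < k) ~~ `[< D i.+1 `<=` D i >])%N = D k.
Proof.
elim: k => [|k IHk] FD Dmono.
  by exists D; rewrite big_ord0; split=> //; split.
have [|i ik|C [[FC Cs] Ck]] := IHk.
- by move=> i ik; apply: FD; rewrite leqW.
- by apply: Dmono; rewrite ltnS ltnW.
rewrite big_ord_recr /=; set s := (\sum_(i < k) _)%N in FC Cs Ck *.
have [DD|nDD] := asboolP (D k.+1 `<=` D k).
  exists C; rewrite addn0 Ck; split=> //.
  by apply/seteqP; split=> //; apply: Dmono.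
exists (fun i => if (i <= s)%N then C i else D k.+1).
rewrite addn1 ltnn; split=> //; split=> i si.
  by case: leqP => is'; [apply: FC | apply: FD].
have [->|ns] := eqVneq i s.
  by rewrite leqnn ltnn Ck; split=> //; apply: Dmono.
have lis : (i < s)%N by rewrite ltn_neqAle ns -ltnS.
by rewrite (ltnW lis) lis; apply: Cs.
Qed.

End Chains.

Lemma sup_chain_length_iso (T T' : Type) (F : set (set T)) (G : set (set T'))
  (f : set T -> set T') (g : set T' -> set T) n :
  (forall A, F A -> G (f A)) -> (forall A, G A -> F (g A)) ->
  (forall A B, A `<=` B -> f A `<=` f B) ->
  (forall A B, A `<=` B -> g A `<=` g B) ->
  (forall A, F A -> g (f A) = A) -> (forall B, G B -> f (g B) = B) ->
  sup_chain_length F n -> sup_chain_length G n.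
Proof.
have transfer (S S' : Type) (H : set (set S)) (K : set (set S'))
    (h : set S -> set S') (h' : set S' -> set S) k C :
    (forall A, H A -> K (h A)) -> (forall A B, A `<=` B -> h A `<=` h B) ->
    (forall A B, A `<=` B -> h' A `<=` h' B) -> (forall A, H A -> h' (h A) = A) ->
    chain_in H k C -> chain_in K k (h \o C).
  move=> HK hm h'm hK [HC Cs]; split=> i ik; first exact/HK/HC.
  have [CC nCC] := Cs _ ik; split; first exact: hm.
  move=> /h'm /=; rewrite !hK //; apply: HC => //; exact: ltnW.
move=> FG GF fm gm fK gK [[C FC] Fn]; split.
  by exists (f \o C); apply: (transfer _ _ F G f g).
move=> k D GD; apply: (Fn _ (g \o D)).
by apply: (transfer _ _ G F g f).
Qed.

Section Length.
Variables (R : comNzRingType) (M : lmodType R).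
Implicit Types (N K L : set M) (u v : M) (n : nat).

(** Chains below and above [K] concatenate. Conversely, a chain leaves a trace below [K] by
    intersection and one above [K] by sum; by the modular law each strict step is strict in at least
    one trace. *)
Lemma quot_length_add N K L a b : submodule N -> submodule K -> L `<=` K -> K `<=` N ->
  quot_length N K a -> quot_length K L b -> quot_length N L (a + b).
Proof.
move=> Ns Ks LK KN [[C [FC Cs]] NKa] [[D [FD Ds]] KLb]; split.
  (* [C 0] is skipped: it contains [K], hence [D b], so the step from [D b] to [C 1] is strict and
     the total is [a + b]. *)
  exists (fun i => if (i <= b)%N then D i else C (i - b)%N); split=> i iab.
    case: leqP => ib.
      by have [? ? DK] := FD _ ib; split=> //; apply: subset_trans KN.
    have [|? KC ?] := FC (i - b)%N; first by lia.
    by split=> //; apply: subset_trans LK KC.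
  have [ib|bi|ib] := ltngtP i b.
  - exact: Ds.
  - by rewrite subSn ?(ltnW bi) //; apply: Cs; lia.
  - have [_ _ DK] := FD _ (leqnn b); have [_ KC _] := FC 0%N isT.
    have DC : D b `<=` C 0%N by apply: subset_trans KC.
    rewrite ib subSn // subnn; have [|CC nCC] := Cs 0%N; first by lia.
    split; first exact: subset_trans CC.
    by move=> CD; apply: nCC; apply: subset_trans DC.
move=> k E [FE Es].
pose D1 i := E i `&` K; pose D2 i := addm (E i) K.
have [|i ik|C1 [FC1 _]] :=
    @weak_chain _ [set A | [/\ submodule A, L `<=` A & A `<=` K]] k D1.
- move=> i ik; have [Eis LE EN] := FE _ ik; split.
  + exact: submoduleI.
  + by move=> u Lu; split; [apply: LE | apply: LK].
  + by move=> u [].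
- by have [EE _] := Es _ ik; move=> u [/EE].
have [|i ik|C2 [FC2 _]] :=
    @weak_chain _ [set A | [/\ submodule A, K `<=` A & A `<=` N]] k D2.
- move=> i ik; have [Eis LE EN] := FE _ ik; split.
  + exact: submodule_addm.
  + exact: sub_addmr.
  + exact: addm_sub.
- by have [EE _] := Es _ ik; apply: addmS.
apply: leq_trans (leq_add (NKa _ _ FC2) (KLb _ _ FC1)).
rewrite -big_split /= -[X in (X <= _)%N]card_ord -sum1_card.
apply: leq_sum => -[i ik] _ /=; have [EE nEE] := Es _ ik.
rewrite addn_gt0 !lt0b -negb_and; apply/negP=> /andP[/asboolP E2 /asboolP E1].
have [Eis _ _] := FE _ (ltnW ik); have [Ei1s _ _] := FE _ ik.
apply: nEE => u Eu; have /E2[v Ev [w Kw uE]] : D2 i.+1 u by apply: sub_addml.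
have /E1[Ew _] : D1 i.+1 w.
  by split=> //; rewrite -uE in Eu; have := submB Ei1s Eu (EE _ Ev); rewrite addrC addKr.
by rewrite -uE; apply: submD.
Qed.

Lemma quot_length0 N : submodule N -> quot_length N N 0.
Proof.
move=> Ns; split.
  by exists (fun=> N); split=> // i _; split.
move=> k C [FC Cs]; case: k FC Cs => // k FC Cs.
have [_ NC0 _] := FC 0%N isT; have [_ _ C1N] := FC 1%N isT.
by have [_] := Cs 0%N isT; case; apply: subset_trans NC0.
Qed.

Lemma quot_length_gt0 N L n : submodule N -> submodule L -> L `<` N ->
  quot_length N L n -> (0 < n)%N.
Proof.
move=> Ns Ls [LN NL] [_ Ln]; apply: (Ln 1%N (fun i => if i is 0 then L else N)).
by split=> -[|i] //; split.
Qed.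

End Length.

Lemma quot_length_image (R : comNzRingType) (M M' : lmodType R) (f : M -> M')
  (K : set M) (L : set M') n :
  (forall a u v, f (a *: u + v) = a *: f u + f v) -> submodule K ->
  submodule L -> quot_length K (K `&` f @^-1` L) n ->
  quot_length (addm (f @` K) L) L n.
Proof.
move=> fl Ks Ls.
have f0 : f 0 = 0.
  by have := fl (-1) 0 0; rewrite scaler0 addr0 scaleN1r addNr.
have imS A : submodule A -> submodule (f @` A).
  move=> As; apply/submoduleP; split; first by exists 0 => //; apply: subm0.
  move=> a _ _ [u Au <-] [v Av <-]; exists (a *: u + v); last exact: fl.
  by apply: submD => //; apply: submZ.
have preS A : submodule A -> submodule (f @^-1` A).
  move=> As; apply/submoduleP; split; first by rewrite /= f0; apply: subm0.
  move=> a u v /= Au Av; rewrite fl.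
  by apply: submD => //; apply: submZ.
have fB u v : f (u - v) = f u - f v by rewrite addrC -scaleN1r fl scaleN1r addrC.
apply: (@sup_chain_length_iso _ _ _ _ (fun A => addm (f @` A) L)
  (fun B => K `&` f @^-1` B)).
- move=> A [As KA AK]; split.
  + by apply: submodule_addm => //; apply: imS.
  + exact/sub_addmr/imS.
  + by apply: addmS => // _ [u /AK Ku <-]; exists u.
- move=> B [Bs LB _]; split.
  + by apply: submoduleI => //; apply: preS.
  + by move=> u [Ku Lu]; split=> //; apply: LB.
  + by move=> u [].
- by move=> A B AB; apply: addmS => // _ [u /AB Bu <-]; exists u.
- by move=> A B AB u [Ku Au]; split=> //; apply: AB.
- move=> A [As KA AK]; apply/seteqP; split=> [u [Ku]|u Au].
    case=> _ [v Av <-] [w Lw /= E]; rewrite -(subrK v u); apply: submD => //.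
    apply: KA; split; first by apply: submB => //; apply: AK.
    by rewrite /= fB -E addrAC subrr add0r.
  by split; [apply: AK | apply: sub_addml => //; exists u].
- move=> B [Bs LB BK]; apply/seteqP; split.
    by apply: addm_sub => // _ [u [_ Bu] <-].
  move=> u Bu; have [_ [v Kv <-] [w Lw uE]] := BK u Bu.
  apply/addmP; exists (f v), w; split=> //; exists v => //; split=> //=.
  by rewrite -uE in Bu; rewrite -(addrK w (f v)); apply: submB => //; apply: LB.
Qed.

Lemma quot_length_modular (R : comNzRingType) (M : lmodType R) (K L : set M) n :
  submodule K -> submodule L -> quot_length K (K `&` L) n ->
  quot_length (addm K L) L n.
Proof.
move=> Ks Ls KL; rewrite -[K in addm K]image_id.
exact: (@quot_length_image _ _ _ id).
Qed.

Definition finite_length (R : comNzRingType) (M : lmodType R) (N L : set M) :=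
  exists n, quot_length N L n.

Section FiniteLength.
Variables (R : comNzRingType) (M : lmodType R) (m : set R).
Hypotheses (noethR : noetherian R) (localR : local_ring m).
Hypothesis fgM : finitely_generated M.
Implicit Types (N K L : set M) (u v : M) (n : nat).

Lemma finite_length_trans N K L : submodule N -> submodule K -> L `<=` K ->
  K `<=` N -> finite_length N K -> finite_length K L -> finite_length N L.
Proof.
by move=> Ns Ks LK KN [a NKa] [b KLb]; exists (a + b)%N; apply: quot_length_add KLb.
Qed.

(** N/L is a finitely generated vector space over the residue field, and each generator adds at most
    1 to the length. *)
Lemma finite_length_residue N L : submodule N -> submodule L -> L `<=` N ->
  (forall a u, m a -> N u -> L (a *: u)) -> finite_length N L.
Proof.
move=> Ns Ls LN mN; have [s sT] := fgM.
have [|t NE] := noetherian_submodule noethR Ns (s := s); first by rewrite sT.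
have -> : N = addm L (submod_gen [set` t]).
  rewrite -NE; apply/seteqP; split; [exact: sub_addmr | exact: addm_sub].
have: [set` t] `<=` N by rewrite NE; apply: sub_submod_gen.
elim: t {NE} => [_|e t IHt etN].
  have -> : addm L (submod_gen [set` [::]]) = L.
    apply/seteqP; split; last exact/sub_addml/submodule_gen.
    by apply: addm_sub => // u /submod_gen_nil ->; apply: subm0.
  by exists 0%N; apply: quot_length0.
have tN : [set` t] `<=` N by move=> u tu; apply: etN; rewrite /= inE [_ \in _]tu orbT.
have Gt := submodule_gen [set` t]; have Gs := submodule_gen [set` e :: t].
set K := addm L (submod_gen [set` t]) in IHt.
have Ks : submodule K by apply: submodule_addm.
have KN : K `<=` addm L (submod_gen [set` e :: t]).
  by apply: addmS => //; apply: submod_genS => u /= tu; rewrite inE tu orbT.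
apply: (@finite_length_trans _ K) => //; first exact: submodule_addm.
- exact: sub_addml.
(* A term strictly above the bottom contains, modulo [K], some c e with c outside [m]; it therefore
   contains [e] and is the top, so no chain has two steps. *)
- apply: (@sup_chain_length_bounded _ _ 1).
    by exists K; split.
  move=> [|[|k]] C [FC Cs] //; exfalso.
  have [C1s KC1 C1N] := FC 1%N isT; have [_ KC0 _] := FC 0%N isT.
  have [_ nC10] := Cs 0%N isT; have [_ nC21] := Cs 1%N isT.
  have [_ _ C2N] := FC 2%N isT.
  have C1e : C 1%N e.
    apply: contrapT => nC1e; apply: nC10 => u C1u; apply: KC0.
    have [v Lv [_ /submod_gen_cons[c [w [tw ->]]] uE]] := C1N u C1u.
    have Kvw : K (v + w) by apply/addmP; exists v, w.
    have uE' : u = c *: e + (v + w) by rewrite -uE addrCA.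
    have [mc|/(local_unit localR)[b bc]] := pselect (m c); last first.
      exfalso; apply: nC1e; rewrite -[e]scale1r -bc -scalerA.
      apply: submZ => //; rewrite -(addrK (v + w) (c *: e)) -uE'.
      by apply: submB => //; apply: KC1.
    rewrite uE'; apply: submD => //; apply: sub_addml => //; apply: mN => //.
    by apply: etN; apply: mem_head.
  apply: nC21; apply: (subset_trans C2N); apply: addm_sub => //.
    by apply: subset_trans KC1; apply: sub_addml.
  move=> _ /submod_gen_cons[c [w [tw ->]]]; apply: submD => //; first exact: submZ.
  by apply: KC1; apply: sub_addmr.
- exact: IHt.
Qed.

Lemma finite_length_radical L (J : set R) : submodule L -> radical J = m ->
  smul J setT `<=` L -> finite_length [set: M] L.
Proof.
move=> Ls Jm JL; have [G mG] := noethR (local_ideal localR).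
have Gm : [set` G] `<=` m by rewrite mG; apply: (@sub_submod_gen R R^o).
(* [gs] holds the generators of [m] known only to act nilpotently on N/K; the others already kill
   it. The outer induction empties [gs], the inner one lowers the exponent of its head. *)
suff H (gs : seq R) N K : submodule N -> submodule K -> K `<=` N ->
    (forall g, g \in gs -> exists n, forall u, N u -> K (g ^+ n *: u)) ->
    (forall g, g \in G -> g \in gs \/ forall u, N u -> K (g *: u)) ->
    finite_length N K.
  apply: (H G) => //; [exact: submoduleT | move=> g /Gm | by left].
  rewrite -Jm => -[n Jn]; exists n => u _; apply: JL; exact: smulM.
elim: gs N K => [|g gs IHgs] N K Ns Ks KN pw kl.
  apply: finite_length_residue => // a u ma Nu.
  move: ma; rewrite mG; move: a.
  apply: (@submod_gen_sub _ _ _ ([set a | K (a *: u)] : set R^o)).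
    exact: ideal_preim.
  by move=> a /kl[//|]; apply.
have [|n gn] := pw g; first exact: mem_head.
elim: n N Ns KN pw kl gn => [|n IHn] N Ns KN pw kl gn.
  have -> : N = K.
    by apply/seteqP; split=> // u /gn; rewrite expr0 scale1r.
  by exists 0%N; apply: quot_length0.
have gNs := submodule_scalem g Ns.
have N's := submodule_addm gNs Ks.
have N'N : addm (scalem g N) K `<=` N by apply: addm_sub => //; apply: scalem_sub.
have KN' : K `<=` addm (scalem g N) K by apply: sub_addmr.
(* On N/(gN + K) the generator g acts as zero, and on (gN + K)/K one power less of g suffices. *)
apply: (finite_length_trans Ns N's) => //.
  apply: IHgs => // h.
    move=> hgs; have [|k hk] := pw h; first by rewrite inE hgs orbT.
    by exists k => u Nu; apply: KN'; apply: hk.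
  case/kl; last by move=> hK; right=> u Nu; apply: KN'; apply: hK.
  rewrite inE => /orP[/eqP ->|]; last by left.
  by right=> u Nu; apply: sub_addml => //; exists u.
apply: IHn => //.
- by move=> h /pw[k hk]; exists k => u /N'N; apply: hk.
- by move=> h /kl[|hK]; [left | right=> u /N'N; apply: hK].
- move=> _ [_ [u Nu <-] [v Kv <-]]; rewrite scalerDr scalerA -exprSr.
  by apply: submD => //; [apply: gn | apply: submZ].
Qed.

End FiniteLength.

(** * Prime chains *)

(** This is depth <= dim, built downwards: the chain obtained after dividing by [a] starts at a
    prime containing [a], and a smaller prime without [a] is put below it. *)
Lemma regular_prime_chain (R : comNzRingType) (m : set R) (M : lmodType R)
  (s : seq R) (N : set M) : local_ring m -> submodule N ->
  [set` s] `<=` m -> regular_mod N s ->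
  foldl (fun N a => addm N (scalem a setT)) N s <> setT ->
  exists C, chain_in [set P | prime_ideal P /\ transporter N `<=` P] (size s) C.
Proof.
move=> localR; elim: s N => [|a s IHs] N Ns /= sm.
  move=> _ NT; exists (fun=> m); split=> // _ _; split; first exact: local_prime.
  apply: proper_sub_local => //; first exact: ideal_transporter.
  by move=> N1; apply: NT; apply/seteqP; split=> // u _; rewrite -[u]scale1r.
case=> Na Ns'; have aMs := submodule_scalem a (@submoduleT _ M).
have N's := submodule_addm Ns aMs.
move=> /(IHs _ N's _ Ns')[|C [FC Cs]].
  by move=> b sb; apply: sm; rewrite /= inE [_ \in _]sb orbT.
have [C0p NC0] := FC 0%N isT; have /prime_idealP[C0i C01 C0M] := C0p.
(* A prime missing [S] lies in [C 0] and does not contain [a]. The transporter of [N] misses [S]: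
   powers of [a] cancel modulo [N], and the remaining [t] would lie in [C 0]. *)
pose S : set R := [set b | exists n t, ~ C 0%N t /\ b = a ^+ n * t].
have C0a : C 0%N a by apply: NC0 => u; apply: sub_addmr => //; exists u.
have [|b Nb [n [t [C0t bE]]]|||q [qp Nq qS]] := @prime_avoiding _ (transporter N) S.
- exact: ideal_transporter.
- apply: C0t; apply: NC0 => u; apply: sub_addml => //.
  have: N (a ^+ n *: (t *: u)) by rewrite scalerA -bE; apply: Nb.
  by elim: n {bE} => [|n IHn]; rewrite ?expr0 ?scale1r // exprS -scalerA => /Na.
- by exists 0%N, 1; rewrite mulr1.
- move=> _ _ [n [t [C0t ->]]] [n' [t' [C0t' ->]]]; exists (n + n')%N, (t * t').
  by split; [case/C0M | rewrite exprD mulrACA].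
exists (fun i => if i is i'.+1 then C i' else q); split=> -[|i] //.
- move=> /FC[Cp NC]; split=> //; apply: subset_trans NC => b Nb u.
  by apply: sub_addml.
- move=> _; split.
    move=> t qt; apply: contrapT => C0t; apply: (qS t) => //.
    by exists 0%N, t; rewrite mul1r.
  move=> /(_ _ C0a) qa; apply: (qS _ qa); exists 1%N, 1.
  by rewrite mulr1.
- exact: Cs.
Qed.

(** * Powers of an ideal generated by a regular sequence *)

Section Powers.
Variables (R : comNzRingType) (M : lmodType R).
Implicit Types (L : set M) (u v : M) (n : nat) (x y : R) (xs : seq R).

Local Notation Q xs := (smul (ideal_gen [set` xs])).

Lemma ideal_gen_consS x xs : ideal_gen [set` xs] `<=` ideal_gen [set` x :: xs].
Proof. by apply: (@submod_genS R R^o) => a /= xsa; rewrite inE xsa orbT. Qed.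

Lemma ideal_gen_head x xs : ideal_gen [set` x :: xs] x.
Proof. by apply: (@sub_submod_gen R R^o); exact: mem_head. Qed.

Lemma smul_consS x xs L : Q xs L `<=` Q (x :: xs) L.
Proof. by apply: smulS => //; apply: ideal_gen_consS. Qed.

(* The reason is that [Q^n M / Q^n L] is a direct sum of copies of [M / L], as
   in [regular_powers_length]. *)
Lemma regular_powers_cancel xs y L n u : regular_rev M xs -> submodule L ->
  Q xs setT `<=` L -> (forall v, L (y *: v) -> L v) ->
  iter n (Q xs) setT u -> iter n (Q xs) L (y *: u) -> iter n (Q xs) L u.
Proof.
elim: xs y L n u => [|x xs IHxs] y L n u.
  by move=> _ Ls _ Ly; case: n => [_ /Ly //|n /=]; rewrite !smul_gen_nil.
move=> [xreg xsreg] Ls QL Ly.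
(* The hypothesis on the shorter list, with [x] for [y] and (xs)M for [L], makes [x] cancellable
   modulo every power. *)
have xcancel k (w : M) : iter k (Q xs) setT (x *: w) -> iter k (Q xs) setT w.
  elim: k => // k IHk; rewrite iterSr => xw.
  have Qs := submodule_smul (ideal_gen [set` xs]) [set: M].
  apply: (IHxs x) => //.
  by apply: IHk; apply: iter_smulS xw.
have xLs : scalem x setT `<=` L.
  by move=> _ [v _ <-]; apply: QL; apply: smulM => //; apply: ideal_gen_head.
have xsL : Q xs setT `<=` L by apply: subset_trans QL; apply: smul_consS.
elim: n u => [|n IHn] u; first by move=> _ /Ly.
rewrite !iter_smul_cons //; last exact: submoduleT.
set Bn := iter n _ setT; set Ln := iter n _ L.
set A := iter n.+1 (Q xs) setT; set Al := iter n.+1 (Q xs) L.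
have Lns : submodule Ln by apply: submodule_iter_smul.
have As : submodule A by apply: submodule_iter_smul; apply: submoduleT.
have Als : submodule Al by apply: submodule_iter_smul.
have Bns : submodule Bn by apply: submodule_iter_smul; apply: submoduleT.
have AlA : Al `<=` A by apply: iter_smulS.
have LnB : Ln `<=` Bn by apply: iter_smulS.
have ALn : A `<=` Ln.
  rewrite /A iterSr => w Aw; apply: iter_smulSl (@ideal_gen_consS x xs) _ _.
  exact: iter_smulS Aw.
have xA w : A w -> Al (x *: w).
  move=> Aw; apply: (@iter_smulS _ _ _ _ _ _ xLs); rewrite iter_smul_scalem; by exists w.
(* Here u = x b + a and y u = x l + l', split by the occurrence of [x]. Then x (l - y b) = y a - l'
   lies in [A], hence so does l - y b. This decouples [a] and [b], which are settled by the
   inductions on [xs] and on [n]. *)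
case=> _ [b Bb <-] [a Aa uE] [_ [l Ll <-] [l' Al' E]].
have Aw : A (l - y *: b).
  apply: xcancel; rewrite -/A.
  have -> : x *: (l - y *: b) = y *: a - l'.
    rewrite scalerBr scalerA mulrC -scalerA; apply/eqP.
    by rewrite subr_eq addrAC eq_sym subr_eq E -uE scalerDr addrC.
  by apply: (submB As); [apply: (submZ _ As) | apply: AlA].
have Ala : Al a.
  apply: (IHxs y) => //.
  have -> : y *: a = x *: (l - y *: b) + l'.
    apply: (addrI (y *: (x *: b))); rewrite -scalerDr uE -E addrA; congr (_ + _).
    by rewrite scalerBr !scalerA [y * x]mulrC addrC subrK.
  by apply: (submD Als) => //; apply: xA.
have Lb : Ln b.
  apply: IHn => //; rewrite -/Ln.
  have -> : y *: b = l - (l - y *: b) by rewrite opprB addrC subrK.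
  by apply: (submB Lns) => //; apply: ALn.
by exists (x *: b); [exists b | exists a].
Qed.

(** On each factor of the filtration of M by powers of (xs), a direct sum of copies of M/(xs)M, [x]
    acts injectively. *)
Lemma regular_cancel x xs k u : regular_rev M (x :: xs) ->
  iter k (Q xs) setT (x *: u) -> iter k (Q xs) setT u.
Proof.
case=> xreg xsreg; elim: k => // k IHk; rewrite iterSr => xu.
have Qs := submodule_smul (ideal_gen [set` xs]) [set: M].
apply: (regular_powers_cancel (y := x)) => //.
by apply: IHk; apply: iter_smulS xu.
Qed.

(** The binomial counts monomials of degree [n] in [size xs] variables; for the empty list the
    truncated predecessor gives 1 at [n = 0] and 0 afterwards. A general [L] lets the induction
    shorten [xs] while keeping [L]. *)
Lemma regular_powers_length xs L l n : regular_rev M xs -> submodule L ->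
  Q xs setT `<=` L -> quot_length setT L l ->
  quot_length (iter n (Q xs) setT) (iter n (Q xs) L)
    ('C((n + size xs).-1, n) * l).
Proof.
elim: xs L n => [|x xs IHxs] L n.
  move=> _ Ls _ Ll; case: n => [|n]; first by rewrite bin0 mul1n.
  rewrite addn0 bin_small // mul0n /= !smul_gen_nil.
  exact/quot_length0/submodule0.
move=> regx Ls QL Ll; have [xreg xsreg] := regx.
have xLs : scalem x setT `<=` L.
  by move=> _ [v _ <-]; apply: QL; apply: smulM => //; apply: ideal_gen_head.
have xsL : Q xs setT `<=` L by apply: subset_trans QL; apply: smul_consS.
elim: n => [|n IHn]; first by rewrite bin0 mul1n.
have BE := iter_smul_cons x xs n (@submoduleT R M).
have LE := iter_smul_cons x xs n Ls.
set B := iter n.+1 _ setT in BE *; set Lw := iter n.+1 _ L in LE *.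
set Bn := iter n _ setT in IHn BE; set Ln := iter n _ L in IHn LE.
set A := iter n.+1 _ setT in BE; set Al := iter n.+1 _ L in LE.
have Lns : submodule Ln by apply: submodule_iter_smul.
have As : submodule A by apply: submodule_iter_smul; apply: submoduleT.
have Als : submodule Al by apply: submodule_iter_smul.
have Bns : submodule Bn by apply: submodule_iter_smul; apply: submoduleT.
have Bs : submodule B by apply: submodule_iter_smul; apply: submoduleT.
have Lws : submodule Lw by apply: submodule_iter_smul.
have xBs := submodule_scalem x Bns; have xLns := submodule_scalem x Lns.
have AlA : Al `<=` A by apply: iter_smulS.
have LnB : Ln `<=` Bn by apply: iter_smulS.
have ALn : A `<=` Ln.
  rewrite /A iterSr => w Aw; apply: iter_smulSl (@ideal_gen_consS x xs) _ _.
  exact: iter_smulS Aw.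
have xA w : A w -> Al (x *: w).
  move=> Aw; apply: (@iter_smulS _ _ _ _ _ _ xLs); rewrite iter_smul_scalem; by exists w.
have xcancel w : A (x *: w) -> A w by apply: regular_cancel.
(* [K] separates the monomials containing [x] from the others: multiplication by [x] identifies K/Lw
   with Bn/Ln, while B/K is A/Al. Pascal's rule adds the two counts. *)
pose K := addm (scalem x Bn) Lw.
have Ks : submodule K by apply: submodule_addm.
have LwK : Lw `<=` K by apply: sub_addmr.
have KB : K `<=` B.
  apply: addm_sub => //; last exact: iter_smulS.
  by rewrite BE; apply: sub_addml.
have lenK : quot_length K Lw ('C((n + (size xs).+1).-1, n) * l).
  apply: (@quot_length_image _ _ _ ( *:%R x)) => //.
    by move=> a u v; rewrite scalerDr !scalerA mulrC.
  rewrite (_ : _ `&` _ = Ln); first exact: IHn.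
  apply/seteqP; split=> [u [Bu]|u Lu].
    rewrite /= LE => -[_ [v Lv <-] [w Alw E]].
    rewrite -(subrK v u); apply: (submD Lns) => //; apply: ALn; apply: xcancel.
    by rewrite scalerBr -E addrAC subrr add0r; apply: AlA.
  split; first exact: LnB.
  by rewrite /= LE; apply: sub_addml => //; exists u.
have lenB : quot_length B K ('C((n.+1 + size xs).-1, n.+1) * l).
  have -> : B = addm A K.
    apply/seteqP; split; last first.
      by apply: addm_sub => //; rewrite BE; apply: sub_addmr.
    rewrite BE; apply: addm_sub; first exact: submodule_addm.
      by move=> u xBu; apply: (sub_addmr As); apply: sub_addml.
    exact: sub_addml.
  apply: quot_length_modular => //.
  rewrite (_ : A `&` K = Al); first exact: IHxs.
  apply/seteqP; split=> [u [Au]|u Alu]; last first.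
    split; first exact: AlA.
    by apply: LwK; rewrite LE; apply: sub_addmr.
  rewrite /K LE => -[_ [b Bb <-] [_ [_ [v Lv <-] [w Alw <-]] uE]].
  have bvA : A (b + v).
    apply: xcancel; have -> : x *: (b + v) = u - w.
      by rewrite scalerDr -uE addrA addrK.
    by apply: (submB As) => //; apply: AlA.
  rewrite -uE addrA -scalerDr; apply: (submD Als) => //; exact: xA.
have := quot_length_add Bs Ks LwK KB lenB lenK.
by rewrite -mulnDl /= !addnS /= -binS.
Qed.

(** Here the binomial counts monomials of degree at most [n], one successive factor for each
    degree. *)
Lemma regular_length xs l n : regular_rev M xs ->
  quot_length setT (Q xs [set: M]) l ->
  quot_length setT (iter n.+1 (Q xs) [set: M]) ('C(n + size xs, size xs) * l).
Proof.
move=> reg Ml; elim: n => [|n IHn]; first by rewrite binn mul1n.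
have Ts := @submoduleT R M.
have Qs k : submodule (iter k (Q xs) [set: M]) by apply: submodule_iter_smul.
have Q1s := Qs 1%N.
have := regular_powers_length n.+1 reg Q1s (fun u h => h) Ml.
rewrite -iterD addn1 => len.
have sub : iter n.+2 (Q xs) [set: M] `<=` iter n.+1 (Q xs) [set: M].
  by rewrite iterS; apply: smul_subr.
have := quot_length_add Ts (Qs n.+1) sub (fun u h => I) IHn len.
have binC k : 'C(k + size xs, size xs) = 'C(k + size xs, k).
  by rewrite -[in RHS]bin_sub ?leq_addr // addKn.
by rewrite !binC -mulnDl addSn /= addnC -binS.
Qed.

End Powers.

(** Bridge from regularity indexed by prefixes to the recursive form; [t] is the prefix already
    absorbed into the submodule. *)
Lemma regular_mod_of_seq (R : comNzRingType) (M : lmodType R) (s t : seq R) :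
  (forall i, (size t <= i < size (t ++ s))%N -> forall u : M,
     smul (ideal_gen [set` take i (t ++ s)]) setT ((t ++ s)`_i *: u) ->
     smul (ideal_gen [set` take i (t ++ s)]) setT u) ->
  regular_mod (smul (ideal_gen [set` t]) [set: M]) s /\
  foldl (fun N a => addm N (scalem a setT))
    (smul (ideal_gen [set` t]) [set: M]) s =
  smul (ideal_gen [set` t ++ s]) [set: M].
Proof.
elim: s t => [|a s IHs] t reg /=; first by rewrite cats0.
rewrite -cat_rcons -smul_gen_rcons; last exact: submoduleT.
have [|regs ->] := IHs (rcons t a).
  rewrite cat_rcons size_rcons => i /andP[ti si] u.
  by apply: reg; rewrite (ltnW ti).
split=> //; split=> // u; have := reg (size t).
rewrite size_cat leqnn /= addnS ltnS leq_addr => /(_ isT u).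
by rewrite take_size_cat // nth_cat ltnn subnn.
Qed.

(* [(l / d!) (X + 1) ... (X + d)] takes the value ['C(n + d, d) * l] at [n]. *)
Lemma binomial_poly (d l : nat) : (0 < l)%N -> exists P : {poly rat},
  [/\ size P = d.+1, l%:R = d`!%:R * lead_coef P &
      forall n : nat, P.[n%:R] = ('C(n + d, d) * l)%:R].
Proof.
move=> l_gt0; pose P0 : {poly rat} := \prod_(i < d) ('X - (- (i.+1%:R))%:P).
have P0m : P0 \is monic by apply: monic_prod => i _; apply: monicXsubC.
have d0 : d`!%:R != 0 :> rat by rewrite pnatr_eq0 -lt0n fact_gt0.
(* Positivity of [l] matters here: a zero leading coefficient would spoil the size [d.+1]. *)
have l0 : l%:R / d`!%:R != 0 :> rat.
  by rewrite mulf_neq0 ?invr_eq0 // pnatr_eq0 -lt0n.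
exists ((l%:R / d`!%:R) *: P0); split.
- rewrite size_scale // /P0 size_prod_XsubC.
  by rewrite /index_enum -enumT size_enum_ord.
- by rewrite lead_coefZ (monicP P0m) mulr1 mulrC divfK.
- move=> n; rewrite hornerZ horner_prod.
  have -> : \prod_(i < d) ('X - (- (i.+1%:R))%:P : {poly rat}).[n%:R] =
      ('C(n + d, d) * d`!)%:R.
    elim: d {P0 P0m d0 l0} => [|d IHd]; first by rewrite big_ord0 bin0.
    have -> : ('C(n + d.+1, d.+1) * d.+1`! = 'C(n + d, d) * d`! * (n + d.+1))%N.
      rewrite factS addnS mulnA [('C(_, _) * d.+1)%N]mulnC -mul_bin_diag.
      by rewrite -mulnA mulnC.
    by rewrite big_ord_recr IHd /= !hornerE opprK -natrD -natrM.
  by rewrite !natrM mulrC -mulrA; congr (_ * _); rewrite mulrCA mulfV ?mulr1.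
Qed.

Theorem proposition5p6 (R : comNzRingType) (m : set R) (d : nat) (I : set R)
  (x : d.-tuple R)
  (noethR : noetherian R)
  (localR : local_ring m)
  (cmR : cohen_macaulay_ring m d)
  (infk : infinite_residue_field m)
  (primI : primary_to m I)
  (parQ : system_of_parameters m x)
  (redQ : reduction (ideal_gen [set` x]%classic) I) :
  forall M : lmodType R,
    ulrich m I (ideal_gen [set` x]%classic) M -> minimal_multiplicity m I M.
Proof.
move=> M [[fgM [d' dimR depthM]] IQ _].
have Ed : d' = d by apply: sup_chain_length_uniq dimR cmR.1.
rewrite Ed in depthM => {d' dimR Ed}.
have Ts := @submoduleT R M.
have [Qp _ radQ] := parQ.2; have [_ _ radI] := primI.
have xm : [set` x] `<=` m.
  move=> a xa; rewrite -radQ; exists 1%N; rewrite expr1.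
  exact: (@sub_submod_gen R R^o).
have [[s [sz sm [sreg sM]]] _] := depthM.
have [|sreg' sE] := @regular_mod_of_seq R M s [::].
  by move=> i /= si u; apply: sreg.
rewrite smul_gen_nil /= in sreg' sE.
(* The sequence [s] gives a chain of length d; conversely, primes above Ann M are primes of R, whose
   chains are bounded by d. *)
have dimM : module_dim M d.
  split.
    have := @regular_prime_chain R m M s [set 0] localR (submodule0 M) sm sreg'.
    by rewrite sz sE => /(_ sM).
  move=> k C [FC Cs]; apply: (cmR.1.2 k C); split=> // i ik.
  by have [] := FC i ik.
have regx : regular_rev M x.
  apply: (koszul_exact_regular_rev noethR localR fgM xm).
  apply: (koszul_exact_regular (submodule0 M) sreg').
    by move=> a sa; rewrite radQ; apply: sm.
  by rewrite size_tuple sz.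
have [l0 Ml0] : finite_length [set: M] (smul I setT).
  apply: (finite_length_radical noethR localR fgM _ radI) => //.
  exact: submodule_smul.
(* If IM = M, then mM = M, and Nakayama's lemma gives M = sM, against the properness included in
   regularity of [s]. *)
have IT_proper : smul I [set: M] <> setT.
  move=> IT; apply: sM; have [t tT] := fgM; apply/seteqP; split=> //.
  rewrite -tT; apply: (nakayama localR); first exact: submodule_smul.
  rewrite tT -{1}IT; apply: subset_trans (sub_addmr _) => //; last exact: submodule_smul.
  by apply: smulS => // a Ia; rewrite -radI; exists 1%N; rewrite expr1.
have l0_gt0 : (0 < l0)%N.
  apply: quot_length_gt0 Ml0 => //; first exact: submodule_smul.
  by split=> // TI; apply: IT_proper; apply/seteqP; split.
have powE n : smul (ideal_exp I n) [set: M] =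
    iter n (smul (ideal_gen [set` x])) [set: M].
  rewrite smul_ideal_exp //; elim: n => //= n IHn.
  rewrite IHn; elim: n {IHn} => [|n IHn] //=.
  (* Multiplications by I and Q commute, so I Q^(n+1) M = Q (I Q^n M). *)
  by rewrite smulC IHn.
have lenE n : quot_length setT (smul (ideal_exp I n.+1) [set: M])
    ('C(n + d, d) * l0).
  rewrite powE -[d in 'C(_ + d, d)](size_tuple x).
  by apply: regular_length => //; rewrite -IQ.
(* The case of exponent 1 and [L] = QM: there are d monomials of degree 1. *)
have Ml1 : quot_length (smul I [set: M]) (smul (ideal_exp I 2) setT) (d * l0).
  rewrite powE IQ.
  have := regular_powers_length 1 regx (submodule_smul _ _) (fun u h => h).
  by move=> /(_ l0); rewrite add1n bin1 size_tuple -{1}IQ; apply.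
exists d, l0, (d * l0)%N; split=> //.
have [P [szP leadP PE]] := binomial_poly d l0_gt0.
exists d, P; split=> //.
  by exists 0%N => n _; exists ('C(n + d, d) * l0)%N.
rewrite -leadP PoszM -mulrDl subrK mul1r; exact: pmulrn.
Qed.
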